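(* Let $(G,+)$ be a locally compact Hausdorff abelian topological group with a fixed Haar measure $|\cdot|$, and let $F\subseteq G$ be a compact subset. Let $E\subseteq G$ be a $|\cdot|$-measurable set which is of positive upper density corresponding to an $F$-Følner sequence $\mathcal{F}=(F_n)_{n=1}^\infty$ in $(G,+,|\cdot|)$, i.e. $\mathrm{D}_{\mathcal{F}}^*(E)>0$. Then for any finitely many $g_1,\dotsc,g_l\in\langle F\rangle$, $$ \mathrm{BD}_*\left(\left\{d\in\mathbb{Z}\,:\,\mathrm{D}_{\mathcal{F}}^*\left(\{u\in E : u+d\{g_1,\dotsc,g_l\}\subseteq E\}\right)>0\right\}\right)>0. $$
   Context: For $F\subseteq G$, an $F$-Følner sequence in $(G,+,|\cdot|)$ is a sequence $(F_n)_{n=1}^\infty$ of compact subsets of $G$ (of positive Haar measure, so that the quotients make sense) such that $\lim_{n\to\infty}\frac{|(g+F_n)\vartriangle F_n|}{|F_n|}=0$ for every $g\in F$ (required only for $g\in F$, not for all $g\in G$). For an $F$-Følner sequence $\mathcal{F}=(F_n)_{n=1}^\infty$ and a $|\cdot|$-measurable set $A\subseteq G$, the upper density of $A$ corresponding to $\mathcal{F}$ is $\mathrm{D}_{\mathcal{F}}^*(A)=\limsup_{n\to\infty}\frac{|A\cap F_n|}{|F_n|}$. $\langle F\rangle$ denotes the (not necessarily closed) subgroup of $G$ generated by $F$. For $d\in\mathbb{Z}$, $u+d\{g_1,\dotsc,g_l\}=\{u+dg_1,\dotsc,u+dg_l\}$. For $S\subseteq\mathbb{Z}$, $\mathrm{BD}_*(S)=\liminf_{N-M\to\infty}\frac{|S\cap[M,N)|}{N-M}$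 is the lower Banach density of $S$ in $\mathbb{Z}$ with respect to counting measure. *)

(* Defs.v *)
From HB Require Import structures.
From mathcomp Require Import all_boot all_order all_algebra.
From mathcomp Require Import all_classical all_reals all_analysis.

Set Implicit Arguments.
Unset Strict Implicit.
Unset Printing Implicit Defensive.

Import Order.TTheory GRing.Theory Num.Theory.
Import numFieldNormedType.Exports.

Local Open Scope classical_set_scope.
Local Open Scope ring_scope.

(* Copy of [G] carrying its Borel sigma-algebra; measurable types are required
   to be pointed, and the chosen point is [0]. *)
Definition borelType (G : topologicalZmodType) : Type := G.

HB.instance Definition _ (G : topologicalZmodType) :=
  Choice.copy (borelType G) G.
HB.instance Definition _ (G : topologicalZmodType) :=
  isPointed.Build (borelType G) (0 : G).

HB.instance Definition _ (G : topologicalZmodType) :=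
  @isMeasurable.Build (sigma_display (@open G)) (borelType G)
    <<s @open G >> (@sigma_algebra0 _ setT (@open G))
    (@sigma_algebraC (borelType G) (@open G))
    (@sigma_algebra_bigcup _ setT (@open G)).

Definition translate (G : zmodType) (g : G) (A : set G) : set G :=
  [set g + x | x in A].

(* A Haar measure is a nonzero translation invariant Radon measure on the
   Borel sets: finite on compact sets, outer regular on Borel sets and inner
   regular on open sets.  Only its values on Borel sets are meaningful. *)
Record is_haar (R : realType) (G : topologicalZmodType)
    (mu : {measure set (borelType G) -> \bar R}) : Prop := IsHaar {
  haar_neq0 : (mu [set: G] != 0)%E ;
  haar_translate : forall (g : G) (A : set (borelType G)),
    measurable A -> mu (translate g A) = mu A ;
  haar_compact : forall K : set G, compact K -> (mu K < +oo)%E ;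
  haar_outer_regular : forall A : set (borelType G), measurable A ->
    mu A = ereal_inf [set mu U | U in [set U : set G | open U /\ A `<=` U]] ;
  haar_inner_regular : forall U : set G, open U ->
    mu U = ereal_sup [set mu K | K in [set K : set G | compact K /\ K `<=` U]]
}.

Definition subgroup_gen (G : zmodType) (F : set G) : set G :=
  smallest [set H : set G | zmod_closed [in H]] F.

(* In the following definitions [m] stands for the measure |.| as a function on
   all subsets; it is meant to be instantiated with the outer measure [mu^*]
   induced by a Haar measure, which coincides with [mu] on the Borel sets. *)

Record folner (R : realType) (G : topologicalZmodType) (m : set G -> \bar R)
    (F : set G) (Fs : (set G)^nat) : Prop := Folner {
  folner_compact : forall n, compact (Fs n) ;
  folner_gt0 : forall n, (0 < m (Fs n))%E ;
  folner_cvg : forall g, F g ->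
    (m (translate g (Fs n) `+` Fs n) / m (Fs n))%E @[n --> \oo] --> (0 : \bar R)%E
}.

Definition upper_density (R : realType) (G : zmodType) (m : set G -> \bar R)
    (Fs : (set G)^nat) (A : set G) : \bar R :=
  limn_esup (fun n => m (A `&` Fs n) / m (Fs n))%E.

(* The liminf as N - M --> oo, over pairs MN = (M, N) of integers, is the
   supremum over K of the infimum over the pairs such that K < N - M. *)
Definition lower_banach_density (R : realType) (S : set int) : \bar R :=
  ereal_sup [set ereal_inf
    [set (counting (S `&` [set` `[MN.1, MN.2[%R])
            / ((MN.2 - MN.1)%:~R)%:E)%E
      | MN in [set MN : int * int | K%:Z < MN.2 - MN.1]] | K in [set: nat]].

Definition pattern_set (G : zmodType) (E : set G) (l : nat) (g : 'I_l -> G)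
    (d : int) : set G :=
  [set u | E u /\ [set u + g i *~ d | i in [set: 'I_l]] `<=` E].

(* Main.v *)
Require Import Defs.
From mathcomp Require Import all_boot all_order all_algebra.
From mathcomp Require Import all_classical all_reals all_analysis.
From mathcomp Require Import ring lra zify.

(**
The statement contains the multidimensional Szemeredi theorem, and the return
times [d] have to be found with bounded gaps. Both come from the density
Hales-Jewett theorem: over a finite alphabet [A] and for every [delta > 0]
there is a length at which each set of words of density at least [delta]
contains a combinatorial line, that is, all words obtained from a pattern with
at least one blank by writing the same letter into every blank.

From words to the group. Let the letters be [0] and the [g_i], and let [n]
integers [d_j] be given. Send a word [t] to the sum of the
[d_j * g_(t_j)], and let [A_t] be the set of the [u] for which [u] plus this sum
lies in [E]. Each of these sums lies in the subgroup generated by [F], along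
which the Folner sequence is asymptotically invariant, so every [A_t] is as
dense as [E] in the same [F_n]. Hence on a set of [u] of positive relative
density the words [t] with [u] in [A_t] form one fixed set of positive density
([dense_atom]). This set contains a line. The blanks of the line give a
nonempty set of indices [j], and if [d] is the sum of the [d_j] over it, a
translate of [{u : u + d * g_i in E for all i}] contains that set of [u]
([IP_recurrence]). So the set of good [d] meets the finite sums of every family
of [n] integers. A set of integers with arbitrarily long gaps misses all finite
sums of some family chosen step by step inside the gaps; therefore the good [d]
have bounded gaps ([IP_syndetic]) and positive lower Banach density
([syndetic_density]).

The density Hales-Jewett theorem is proved by induction on the alphabet, as in
the argument of Dodos, Kanellopoulos and Tyros, itself modelled on Polymath's.
Suppose that it holds for [A], and let [option A] be the larger alphabet. Let
[d] be the infimum of the densities that force a line, and suppose [d > 0]. Take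
a set [D] without lines, of density almost [d], whose restrictions to large
subspaces have density not much above [d].

  - By the theorem for [A] and a Ramsey argument ([Graham_Rothschild_lines])
    there is a subspace in which each line over [A] lies in [D] for a proportion
    of the choices of the remaining letters that is bounded below.

  - For each such choice let [C] be the set of the words [w] whose line over [A]
    (obtained by reading the letter [None] of [w] as a blank) lies in [D]. As
    [w] is the missing point of a line over [option A], the set [D] is almost
    disjoint from [C]. So [D] is denser than [d] outside [C].

  - The set [C] is an intersection, over the letters [a] of [A], of sets
    insensitive to exchanging [None] and [a]. By the theorem for [A], every such
    set is up to a small error a disjoint union of large subspaces, and so is
    every atom of the algebra that they generate
    ([insensitive_exhaust], [insensitive_exhaust_seq]). Hence [D] is denser than
    [d] on some large subspace ([DHJ_step]), a contradiction.
*)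

Set Implicit Arguments.
Unset Strict Implicit.
Unset Printing Implicit Defensive.

Import Order.TTheory GRing.Theory Num.Theory.

(** * Words, lines and subspaces *)

Notation word I A := {ffun I -> A}.

Definition wcat (I J : finType) (A : Type) (x : word I A) (y : word J A) :
  word (I + J)%type A :=
  [ffun s => match s with inl i => x i | inr j => y j end].

Definition wsome (I : finType) (A : Type) (w : word I A) : word I (option A) :=
  [ffun i => Some (w i)].

(** A word over [option A] is a word over [A] with blanks [None]; when it has a
    blank, its fillings are the points of a combinatorial line. *)
Definition plug (I : finType) (A : Type) (a : A) (v : word I (option A)) :
  word I A :=
  [ffun i => odflt a (v i)].

Definition variable (I : finType) (A : finType) (v : word I (option A)) :=
  [exists i, v i == None].

(** An element of [word I (A + J)] is a parametrised set of words: the coordinates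
    [inl a] are constant and the coordinates [inr j] all carry the parameter [j].
    It is a subspace of dimension [#|J|] when it is [onto]. *)
Definition point (I J : finType) (A : Type) (s : word I (A + J)%type)
  (w : word J A) : word I A :=
  [ffun i => match s i with inl a => a | inr j => w j end].

Definition onto (I J A : finType) (s : word I (A + J)%type) :=
  [forall j, exists i, s i == inr j].

(** Subspaces over [A] act on words with blanks, hence on lines. *)
Definition enlarge (I J : finType) (A : Type) (s : word I (A + J)%type) :
  word I (option A + J)%type :=
  [ffun i => match s i with inl a => inl (Some a) | inr j => inr j end].

Definition compose (I J K : finType) (A : Type) (s : word I (A + J)%type)
  (t : word J (A + K)%type) : word I (A + K)%type :=
  [ffun i => match s i with inl a => inl a | inr j => t j end].

Lemma variableP (I A : finType) (v : word I (option A)) :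
  reflect (exists i, v i = None) (variable v).
Proof. by apply: (iffP existsP) => -[i /eqP]; exists i => //; apply/eqP. Qed.

Lemma ontoP (I J A : finType) (s : word I (A + J)%type) :
  reflect (forall j, exists i, s i = inr j) (onto s).
Proof.
apply: (iffP forallP) => h j.
  by have /existsP[i /eqP si] := h j; exists i.
by have [i si] := h j; apply/existsP; exists i; apply/eqP.
Qed.

(** Reading the letter [None] of a word over [option A] as a blank turns the word
    into a line over [option A] with constants in [A], whose point at [None] is
    the word itself. Thus the same word encodes a line over [A] and the point
    that completes this line over [option A]. *)
Definition widen_line (I : finType) (A : Type) (u : word I (option A)) :
  word I (option (option A)) := [ffun i => omap Some (u i)].

Section Words.
Variables (I J K A : finType).
Implicit Types (s : word I (A + J)%type) (t : word J (A + K)%type).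

Lemma plug_wsome (a : A) (w : word I A) : plug a (wsome w) = w.
Proof. by apply/ffunP=> i; rewrite !ffunE. Qed.

Lemma plug_widen_None (u : word I (option A)) : plug None (widen_line u) = u.
Proof. by apply/ffunP=> i; rewrite !ffunE; case: (u i). Qed.

Lemma plug_widen_Some (a : A) (u : word I (option A)) :
  plug (Some a) (widen_line u) = wsome (plug a u).
Proof. by apply/ffunP=> i; rewrite !ffunE; case: (u i). Qed.

Lemma variable_widen (u : word I (option A)) : variable u -> variable (widen_line u).
Proof.
by case/variableP=> i ui; apply/variableP; exists i; rewrite ffunE ui.
Qed.

Lemma plug_wcat (a : A) (x : word I (option A)) (y : word J (option A)) :
  plug a (wcat x y) = wcat (plug a x) (plug a y).
Proof. by apply/ffunP=> -[i|j]; rewrite !ffunE. Qed.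

Lemma variable_wcatl (x : word I (option A)) (y : word J (option A)) :
  variable x -> variable (wcat x y).
Proof. by case/variableP=> i xi; apply/variableP; exists (inl i); rewrite ffunE. Qed.

Lemma variable_wcatr (x : word I (option A)) (y : word J (option A)) :
  variable y -> variable (wcat x y).
Proof. by case/variableP=> i xi; apply/variableP; exists (inr i); rewrite ffunE. Qed.

Lemma nonvariable (a : A) (v : word I (option A)) : ~~ variable v ->
  v = wsome (plug a v).
Proof.
move=> nv; apply/ffunP=> i; rewrite !ffunE; case E: (v i) => [//|].
by case/variableP: nv; exists i.
Qed.

Lemma plug_point (a : A) s (w : word J (option A)) :
  plug a (point (enlarge s) w) = point s (plug a w).
Proof. by apply/ffunP=> i; rewrite !ffunE; case: (s i) => // j; rewrite ffunE. Qed.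

Lemma point_wsome s (x : word J A) : point (enlarge s) (wsome x) = wsome (point s x).
Proof. by apply/ffunP=> i; rewrite !ffunE; case: (s i) => // j; rewrite ffunE. Qed.

Lemma point_compose s t w : point (compose s t) w = point s (point t w).
Proof. by apply/ffunP=> i; rewrite !ffunE; case: (s i) => // j; rewrite ffunE. Qed.

Lemma onto_compose s t : onto s -> onto t -> onto (compose s t).
Proof.
move=> /ontoP hs /ontoP ht; apply/ontoP=> k.
have [j tj] := ht k; have [i si] := hs j; exists i.
by rewrite ffunE si.
Qed.

Lemma onto_enlarge s : onto s -> onto (enlarge s).
Proof.
by move=> /ontoP hs; apply/ontoP=> j; have [i si] := hs j; exists i; rewrite ffunE si.
Qed.

Lemma variable_point s (w : word J (option A)) :
  onto s -> variable w -> variable (point (enlarge s) w).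
Proof.
move=> /ontoP hs /variableP[j wj]; have [i si] := hs j.
by apply/variableP; exists i; rewrite !ffunE si.
Qed.

Lemma plug_point_plug (a : A) (s : word I (option A + J)%type) (w : word J (option A)) :
  plug a (point s (wsome (plug a w))) = plug a (point s w).
Proof. by apply/ffunP=> i; rewrite !ffunE; case: (s i) => // j; rewrite !ffunE. Qed.

End Words.

(** Alphabets and sets of coordinates are arbitrary finite types, up to
    bijection; this principle replaces inductions on their cardinals. *)
Lemma finType_ind (P : finType -> Prop) :
  (forall (I J : finType) (f : I -> J), bijective f -> P I -> P J) ->
  P void -> (forall I : finType, P I -> P (option I)) -> forall I, P I.
Proof.
move=> Pbij P0 PS I; move eqn : #|I| => n.
elim: n I eqn => [|n IHn] I In.
  have I0 (i : I) : False by have := fintype0 i; rewrite In.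
  apply: (Pbij void I (fun x : void => match x with end)) => //.
  by exists (fun i : I => match I0 i with end) => [[]|i]; case: (I0 i).
have e : n.+1 = #|{: option 'I_n}| by rewrite card_option card_ord.
have e' : #|{: option 'I_n}| = #|I| by rewrite -e.
apply: (Pbij {: option 'I_n} I
  (fun x => enum_val (cast_ord e' (enum_rank x)))); last first.
  by apply: PS; apply: IHn; rewrite card_ord.
exists (fun i => enum_val (cast_ord (esym e') (enum_rank i))) => x.
  by rewrite enum_valK cast_ordK enum_rankK.
by rewrite enum_valK cast_ordKV enum_rankK.
Qed.

(** * The Hales-Jewett theorem *)

Definition HJ_for (A r : finType) := exists I : finType,
  forall c : word I A -> r, exists v : word I (option A),
    variable v /\ forall a b, c (plug a v) = c (plug b v).

Section ColourFocusing.
Variables (A : finType) (a0 : A) (HJ_A : forall r, HJ_for A r) (r : finType).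

Let mono (I : finType) (c : word I (option A) -> r) := exists v : word I (option (option A)),
    variable v /\ forall a b, c (plug a v) = c (plug b v).

Let focused n (I : finType) (c : word I (option A) -> r) :=
  exists (x : word I (option A)) (s : seq (word I (option (option A)))),
  [/\ size s = n,
      forall v, v \in s -> [/\ variable v, plug None v = x &
        forall a b, c (plug (Some a) v) = c (plug (Some b) v)] &
      uniq [seq c (plug (Some a0) v) | v <- s]].

(** If no line is monochromatic, one obtains [n] lines through a common point
    [x], their point at [None]; each is monochromatic away from [x], and their
    colours are distinct. For [n] larger than the number of colours this is
    absurd. One more line is gained by prefixing a line over [A] along which the
    colouring of the suffixes is constant. *)
Lemma colour_focusing n : exists I : finType, forall c : word I (option A) -> r,
  mono c \/ focused n c.
Proof.
elim: n => [|n [I IH]].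
  exists void => c; right; exists [ffun=> None], [::]; split=> //.
have [I' HI'] := HJ_A {ffun word I (option A) -> r}.
exists (I' + I)%type => c.
have [L [vL mL]] := HI' (fun x => [ffun y => c (wcat (wsome x) y)]).
pose L' := widen_line L.
have L'S a : plug (Some a) L' = wsome (plug a L) by exact: plug_widen_Some.
have vL' : variable L' by exact: variable_widen.
pose c' y := c (wcat (wsome (plug a0 L)) y).
have c'E a y : c (wcat (wsome (plug a L)) y) = c' y.
  by have /ffunP/(_ y) := mL a a0; rewrite !ffunE.
have lift_mono v : variable v -> (forall a b, c' (plug a v) = c' (plug b v)) -> mono c.
  move=> vv mv; exists (wcat (wsome (wsome (plug a0 L))) v); split.
    exact: variable_wcatr.
  by move=> a b; rewrite !plug_wcat !plug_wsome; apply: mv.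
have [[v [vv mv]]|[y [s [ss sP us]]]] := IH c'; first by left; exact: (lift_mono v).
have [/mapP[v vs c'y]|yns] := boolP (c' y \in [seq c' (plug (Some a0) v) | v <- s]).
  left; apply: (lift_mono v); first by case: (sP v vs).
  have [_ vy mv] := sP v vs.
  suff E a : c' (plug a v) = c' y by move=> a b; rewrite !E.
  by case: a => [a|]; rewrite ?vy // (mv a a0).
right; exists (wcat (plug None L') y), (wcat L' (wsome y) :: [seq wcat L' v | v <- s]).
have cE a v : c (plug (Some a) (wcat L' v)) = c' (plug (Some a) v).
  by rewrite plug_wcat L'S c'E.
split.
- by rewrite /= size_map ss.
- move=> v; rewrite inE => /orP[/eqP ->|/mapP[u us' ->]].
    split; first exact: variable_wcatl.
      by rewrite plug_wcat plug_wsome.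
    by move=> a b; rewrite !cE !plug_wsome.
  have [vu uy mu] := sP u us'; split; first exact: variable_wcatl.
    by rewrite plug_wcat uy.
  by move=> a b; rewrite !cE.
- rewrite /= cE plug_wsome -map_comp.
  rewrite (eq_map (g := fun v => c' (plug (Some a0) v))) ?yns // => v.
  exact: cE.
Qed.

End ColourFocusing.

Lemma HJ_step (A r : finType) : (0 < #|A|)%N -> (forall r, HJ_for A r) ->
  HJ_for (option A) r.
Proof.
case/card_gt0P=> a0 _ HA; have [I HI] := colour_focusing a0 HA r #|r|.+1.
exists I => c; case: (HI c) => // -[x [s [ss _ us]]].
by have := max_card (mem [seq c (plug (Some a0) v) | v <- s]);
  rewrite (card_uniqP us) size_map ss ltnn.
Qed.

Theorem HJ (A r : finType) : HJ_for A r.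
Proof.
move: r; elim/finType_ind: A => [A B f [g fK gK] HA r||A HA r].
- have [I HI] := HA r; exists I => c.
  have [v [vv mv]] := HI (fun x => c [ffun i => f (x i)]).
  exists [ffun i => omap f (v i)]; split.
    by case/variableP: vv => i vi; apply/variableP; exists i; rewrite ffunE vi.
  have E b : plug b [ffun i => omap f (v i)] = [ffun i => f (plug (g b) v i)].
    by apply/ffunP=> i; rewrite !ffunE; case: (v i) => //=; rewrite gK.
  by move=> a b; rewrite !E; apply: mv.
- move=> r; exists unit => c; exists [ffun=> None]; split=> [|[]//].
  by apply/variableP; exists tt; rewrite ffunE.
have [A0|A0] := posnP #|A|; last exact: HJ_step.
exists unit => c; exists [ffun=> None]; split.
  by apply/variableP; exists tt; rewrite ffunE.
by move=> [a|] [b|] //; have := fintype0; first [move/(_ _ a)|move/(_ _ b)]; rewrite A0.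
Qed.

(** * Multidimensional Hales-Jewett and the Graham-Rothschild theorem for lines *)

Definition relabel (I J K : finType) (A : Type) (f : J -> K)
  (s : word I (A + J)%type) : word I (A + K)%type :=
  [ffun i => match s i with inl a => inl a | inr j => inr (f j) end].

Definition line_sub (I J : finType) (A : Type) (v : word I (option A)) :
  word I (A + option J)%type :=
  [ffun i => if v i is Some a then inl a else inr None].

Lemma point_relabel (I J K : finType) (A : Type) (f : J -> K)
    (s : word I (A + J)%type) (w : word K A) :
  point (relabel f s) w = point s [ffun j => w (f j)].
Proof. by apply/ffunP=> i; rewrite !ffunE; case: (s i) => // j; rewrite ffunE. Qed.

Lemma enlarge_relabel (I J K : finType) (A : Type) (f : J -> K)
    (s : word I (A + J)%type) :
  enlarge (relabel f s) = relabel f (enlarge s).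
Proof. by apply/ffunP=> i; rewrite !ffunE; case: (s i) => // j; rewrite ffunE. Qed.

Lemma onto_relabel (I J K A : finType) (f : J -> K) (s : word I (A + J)%type) :
  bijective f -> onto s -> onto (relabel f s).
Proof.
move=> [g _ gK] /ontoP hs; apply/ontoP=> k; have [i si] := hs (g k).
by exists i; rewrite ffunE si gK.
Qed.

Lemma point_line_sub (I J : finType) (A : Type) (v : word I (option A))
    (w : word (option J) A) : point (line_sub J v) w = plug (w None) v.
Proof. by apply/ffunP=> i; rewrite !ffunE; case: (v i). Qed.

Lemma point_enlarge_line_sub (I J : finType) (A : Type) (v : word I (option A))
    (w : word (option J) (option A)) :
  point (enlarge (line_sub J v)) w = [ffun i => if v i is Some a then Some a else w None].
Proof. by apply/ffunP=> i; rewrite !ffunE; case: (v i). Qed.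

Lemma point_wcat (I I' J : finType) (A : Type) (s : word I (A + J)%type)
  (t : word I' (A + J)%type) w : point (wcat s t) w = wcat (point s w) (point t w).
Proof. by apply/ffunP=> -[i|i]; rewrite !ffunE. Qed.

Lemma onto_line_cat (I I' J A : finType) (v : word I (option A))
    (t : word I' (A + J)%type) : variable v -> onto t ->
  onto (wcat (line_sub J v) (relabel (@Some J) t)).
Proof.
move=> /variableP[i vi] /ontoP ht; apply/ontoP=> -[j|].
  by have [k tk] := ht j; exists (inr k); rewrite !ffunE tk.
by exists (inl i); rewrite !ffunE vi.
Qed.

(** A colouring of [word (I1 + I2) A] colours the words over [I1] by functions on
    the words over [I2]; a monochromatic line over [I1] adds one parameter to
    the subspace found over [I2]. *)
Theorem multidimensional_HJ (A J r : finType) : exists I : finType,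
  forall c : word I A -> r, exists s : word I (A + J)%type,
    onto s /\ forall x y, c (point s x) = c (point s y).
Proof.
elim/finType_ind: J => [J K f fbij [I HI]||J [I2 HI2]].
- exists I => c; have [s [os ms]] := HI c.
  exists (relabel f s); split; first exact: onto_relabel.
  by move=> x y; rewrite !point_relabel.
- exists void => c; exists [ffun x : void => match x with end]; split.
    by apply/ontoP=> -[].
  by move=> x y; congr c; apply/ffunP=> -[].
have [A0|/card_gt0P[a0 _]] := posnP #|A|.
  exists (option J) => c; exists [ffun j => inr j]; split.
    by apply/ontoP=> j; exists j; rewrite ffunE.
  by move=> x; have := fintype0 (x None); rewrite A0.
have [I1 HI1] := HJ A {ffun word I2 A -> r}.
exists (I1 + I2)%type => c.
have [v [vv mv]] := HI1 (fun x => [ffun y => c (wcat x y)]).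
have [s [os ms]] := HI2 (fun y => c (wcat (plug a0 v) y)).
exists (wcat (line_sub J v) (relabel Some s)); split; first exact: onto_line_cat.
suff E x : c (point (wcat (line_sub J v) (relabel Some s)) x) =
    c (wcat (plug a0 v) (point s [ffun j => x (Some j)])).
  by move=> x y; rewrite !E; apply: ms.
rewrite point_wcat point_line_sub point_relabel.
by have /ffunP/(_ (point s [ffun j => x (Some j)])) := mv (x None) a0; rewrite !ffunE.
Qed.

(** The Graham-Rothschild theorem needs ordered coordinates: [None] is the first
    coordinate of [chain n.+1], and [ccat] is concatenation in this order. *)
Fixpoint chain n : finType := if n is m.+1 then option (chain m) else void.

Lemma chainP (I : finType) : exists n (f : chain n -> I), bijective f.
Proof.
elim/finType_ind: I => [I J f fb [n [g gb]]||I [n [g [h gK hK]]]].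
- by exists n, (f \o g); apply: bij_comp.
- by exists 0, id; exists id.
exists n.+1, (fun o : option (chain n) => omap g o), (omap h) => -[x|] //=.
  by rewrite gK.
by rewrite hK.
Qed.

Definition wcons (K : finType) (B : Type) (b : B) (s : word K B) :
  word (option K) B := [ffun o => if o is Some k then s k else b].

Fixpoint ccat (B : Type) m n :
    word (chain m) B -> word (chain n) B -> word (chain (m + n)) B :=
  if m is m'.+1 return
    word (chain m) B -> word (chain n) B -> word (chain (m + n)) B
  then fun x s => wcons (x None) (ccat [ffun k => x (Some k)] s)
  else fun _ s => s.

Lemma ccat_map (B C : Type) (f : B -> C) m n (x : word (chain m) B)
    (s : word (chain n) B) :
  [ffun i => f (ccat x s i)] = ccat [ffun i => f (x i)] [ffun i => f (s i)].
Proof.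
elim: m x => [|m IH] x /=; first by apply/ffunP=> i; rewrite !ffunE.
rewrite ffunE; apply/ffunP=> -[k|]; rewrite !ffunE //.
have /ffunP/(_ k) := IH [ffun k => x (Some k)]; rewrite ffunE => ->.
by congr (ccat _ _ _); apply/ffunP=> j; rewrite !ffunE.
Qed.

Lemma ccat_l (B : Type) m n (x : word (chain m) B) (s : word (chain n) B) i :
  exists k, ccat x s k = x i.
Proof.
elim: m x i => [|m IH] x [] //=; last by exists None; rewrite ffunE.
move=> i; have [k E] := IH [ffun k => x (Some k)] i.
by exists (Some k); rewrite ffunE E ffunE.
Qed.

Lemma ccat_r (B : Type) m n (x : word (chain m) B) (s : word (chain n) B) i :
  exists k, ccat x s k = s i.
Proof.
elim: m x => [|m IH] x /=; first by exists i.
by have [k E] := IH [ffun k => x (Some k)]; exists (Some k); rewrite ffunE E.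
Qed.

Lemma point_ccat (J : finType) (A : Type) m n (s : word (chain m) (A + J)%type)
  (t : word (chain n) (A + J)%type) w : point (ccat s t) w = ccat (point s w) (point t w).
Proof. exact: (ccat_map (fun e => match e with inl a => a | inr j => w j end)). Qed.

Lemma enlarge_ccat (J : finType) (A : Type) m n (s : word (chain m) (A + J)%type)
  (t : word (chain n) (A + J)%type) : enlarge (ccat s t) = ccat (enlarge s) (enlarge t).
Proof.
exact: (ccat_map (fun e => match e with inl a => inl (Some a) | inr j => inr j end)).
Qed.

Section GrahamRothschild.
Variable (A : finType).

(** The colour of a word with blanks depends only on its letters before the first
    blank; nothing is required of words without blanks. *)
Fixpoint ignores_suffix (r : Type) n : (word (chain n) (option A) -> r) -> Prop :=
  if n is m.+1 return (word (chain n) (option A) -> r) -> Prop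
  then fun c => (forall s s', c (wcons None s) = c (wcons None s')) /\
                forall a, ignores_suffix (fun s => c (wcons (Some a) s))
  else fun _ => True.

Lemma ignores_suffix_comp (r r' : Type) (g : r -> r') n (c : word (chain n) (option A) -> r)
    (c' : word (chain n) (option A) -> r') :
  (forall w, c' w = g (c w)) -> ignores_suffix c -> ignores_suffix c'.
Proof.
elim: n c c' => [//|n IH] c c' E [h1 h2]; split=> [s s'|a].
  by rewrite !E (h1 s s').
by apply: IH (h2 a) => w.
Qed.

Lemma ignores_suffix_ccat (r : Type) m n (c : word (chain (m + n)) (option A) -> r) :
  ignores_suffix c ->
  (forall x : word (chain m) (option A), variable x ->
     forall s s', c (ccat x s) = c (ccat x s')) /\
  forall x : word (chain m) A, ignores_suffix (fun s => c (ccat (wsome x) s)).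
Proof.
elim: m c => [|m IH] c; first by move=> h; split=> // x /variableP[[]].
move=> [h1 h2]; split.
  move=> x vx s s' /=; case xN: (x None) => [a|]; last exact: h1.
  have [] := IH _ (h2 a) => h _; apply: h.
  by case/variableP: vx => -[i|] xi; rewrite ?xN // in xi *;
    apply/variableP; exists i; rewrite ffunE.
move=> x; have [_ /(_ [ffun k => x (Some k)])] := IH _ (h2 (x None)).
apply: (ignores_suffix_comp (g := id)) => s /=; rewrite ffunE.
by congr (c (wcons _ (ccat _ _))); apply/ffunP=> k; rewrite !ffunE.
Qed.

(** With a blank in first place, multidimensional Hales-Jewett over [option A]
    makes the colour independent of the suffix on a subspace [T], whose constants
    may however be blanks. These are tied to the first parameter: they are then
    blank exactly when the first letter is. The other first letters are treated
    simultaneously by the induction hypothesis, with colours [{ffun A -> r}]. *)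
Lemma suffix_ignoring_subspace n (r : finType) : exists I : finType,
  forall c : word I (option A) -> r, exists s : word I (A + chain n)%type,
    onto s /\ ignores_suffix (fun w => c (point (enlarge s) w)).
Proof.
elim: n r => [|n IH] r.
  exists void => c; exists [ffun x : void => match x with end]; split=> //.
  by apply/ontoP=> -[].
have [N HN] := IH {ffun A -> r}.
have [N2 HN2] := multidimensional_HJ (option A) N r.
exists (option N2) => c.
have [T [oT mT]] := HN2 (fun s => c (wcons None s)).
pose Tx x : word N2 (option A + N)%type := [ffun i => match T i with
  | inl b => inl (if b is Some b then Some b else x) | inr j => inr j end].
have [S [oS fS]] := HN (fun s => [ffun a => c (wcons (Some a) (point (Tx (Some a)) s))]).
pose U : word (option N2) (A + option (chain n))%type := [ffun o =>
  if o is Some i then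
    match T i with
    | inl (Some a) => inl a
    | inl None => inr None
    | inr j => match S j with inl a => inl a | inr k => inr (Some k) end
    end
  else inr None].
have UE x s : point (enlarge U) (wcons x s) = wcons x (point (Tx x) (point (enlarge S) s)).
  apply/ffunP=> -[i|]; rewrite !ffunE //=.
  case: (T i) => [[a|]|j]; rewrite ?ffunE //.
  by case: (S j) => // k; rewrite ffunE.
have TN : Tx None = T.
  by apply/ffunP=> i; rewrite ffunE; case: (T i) => // -[].
exists U; split.
  apply/ontoP=> -[k|]; last by exists None; rewrite ffunE.
  have /ontoP/(_ k)[j Sj] := oS; have /ontoP/(_ j)[i Ti] := oT.
  by exists (Some i); rewrite ffunE Ti Sj.
split=> [s s'|a]; first by rewrite !UE TN; apply: mT.
apply: (ignores_suffix_comp (g := fun f : {ffun A -> r} => f a) _ fS) => w.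
by rewrite UE ffunE.
Qed.

Definition mono_sub b p n (c : word (chain n) (option A) -> bool) :=
  exists s : word (chain n) (A + chain p)%type,
    onto s /\ forall w, variable w -> c (point (enlarge s) w) = b.

Variable a0 : A.

Lemma mono_sub_const b p m n (c : word (chain (m + n)) (option A) -> bool)
    (x : word (chain m) A) :
  mono_sub b p (fun s => c (ccat (wsome x) s)) -> mono_sub b p c.
Proof.
move=> [s [/ontoP os ms]]; exists (ccat [ffun i => inl (x i)] s); split.
  apply/ontoP=> j; have [i si] := os j.
  by have [k E] := ccat_r [ffun i => inl (x i)] s i; exists k; rewrite E.
move=> w vw; rewrite -(ms w vw) enlarge_ccat point_ccat; congr (c (ccat _ _)).
by apply/ffunP=> i; rewrite !ffunE.
Qed.

(** A prefix line [v] adds a parameter to a subspace of colour [b]: if the new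
    letter is not blank, its value does not change the colour of the suffix; if
    it is blank, the colour is that of [v], whatever the suffix. *)
Lemma mono_sub_line b p m n (c : word (chain (m + n)) (option A) -> bool)
    (v : word (chain m) (option A)) :
  variable v ->
  (forall a s, c (ccat (wsome (plug a v)) s) = c (ccat (wsome (plug a0 v)) s)) ->
  (forall s, c (ccat v s) = b) ->
  mono_sub b p (fun s => c (ccat (wsome (plug a0 v)) s)) ->
  mono_sub b p.+1 c.
Proof.
move=> /variableP[i0 vi0] cv cb [s [/ontoP os ms]].
exists (ccat (line_sub (chain p) v) (relabel Some s)); split.
  apply/ontoP=> -[j|].
    have [i si] := os j.
    have [k E] := ccat_r (line_sub (chain p) v) (relabel Some s) i.
    by exists k; rewrite E ffunE si.
  have [k E] := ccat_l (line_sub (chain p) v) (relabel Some s) i0.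
  by exists k; rewrite E ffunE vi0.
move=> w vw; rewrite enlarge_ccat point_ccat point_enlarge_line_sub.
case wN : (w None) => [a|].
  rewrite [X in ccat X](_ : _ = wsome (plug a v)); last first.
    by apply/ffunP=> i; rewrite !ffunE; case: (v i).
  rewrite cv enlarge_relabel point_relabel ms //.
  case/variableP: vw => -[j|] wj; rewrite ?wN // in wj *.
  by apply/variableP; exists j; rewrite ffunE.
rewrite [X in ccat X](_ : _ = v) //.
by apply/ffunP=> i; rewrite !ffunE; case: (v i).
Qed.

Definition two_color_bound n p q :=
  forall c : word (chain n) (option A) -> bool, ignores_suffix c ->
  mono_sub true p c \/ mono_sub false q c.

Lemma two_color_bound_le m n p q : two_color_bound n p q -> two_color_bound (m + n) p q.
Proof.
move=> h c /ignores_suffix_ccat[_ /(_ [ffun=> a0])]/h.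
by case=> /mono_sub_const; [left|right].
Qed.

Lemma HJ_chain (r : finType) : exists n, forall c : word (chain n) A -> r,
  exists v : word (chain n) (option A),
    variable v /\ forall a b, c (plug a v) = c (plug b v).
Proof.
have [I HI] := HJ A r; have [n [f [g fK gK]]] := chainP I.
exists n => c; have [v [vv mv]] := HI (fun x => c [ffun k => x (f k)]).
exists [ffun k => v (f k)]; split.
  by case/variableP: vv => i vi; apply/variableP; exists (g i); rewrite ffunE gK.
have E a : plug a [ffun k => v (f k)] = [ffun k => plug a v (f k)].
  by apply/ffunP=> k; rewrite !ffunE.
by move=> a b; rewrite !E.
Qed.

Lemma mono_sub0 b (c : word (chain 0) (option A) -> bool) : mono_sub b 0 c.
Proof.
exists [ffun x : void => match x with end]; split; first by apply/ontoP=> -[].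
by move=> w /variableP[[]].
Qed.

(** As in Ramsey's theorem, by induction on [p + q]: a prefix line along which the
    colouring of the suffixes is constant extends either the subspace of colour
    [true] or that of colour [false], according to its own colour. *)
Lemma two_color_boundP p q : exists n, two_color_bound n p q.
Proof.
move eqN: (p + q)%N => N; elim: N p q eqN => [|N IH] [|p] [|q] //= eqN;
  try (by exists 0 => c _; left; apply: mono_sub0);
  try (by exists 0 => c _; right; apply: mono_sub0).
have [n1 H1] : exists n, two_color_bound n p q.+1 by apply: IH; case: eqN.
have [n2 H2] : exists n, two_color_bound n p.+1 q by apply: IH; rewrite addSnnS; case: eqN.
have [m Hm] := HJ_chain {ffun word (chain (n1 + n2)) (option A) -> bool}.
exists (m + (n1 + n2))%N => c isc.
have [v [vv mv]] := Hm (fun x => [ffun s => c (ccat (wsome x) s)]).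
have cv a s : c (ccat (wsome (plug a v)) s) = c (ccat (wsome (plug a0 v)) s).
  by have /ffunP/(_ s) := mv a a0; rewrite !ffunE.
have [cvar isx] := ignores_suffix_ccat isc.
pose s0 : word (chain (n1 + n2)) (option A) := [ffun=> None].
have cb s : c (ccat v s) = c (ccat v s0) by apply: cvar.
case E: (c (ccat v s0)) cb => cb.
  have: two_color_bound (n1 + n2) p q.+1 by rewrite addnC; apply: two_color_bound_le.
  move=> /(_ _ (isx (plug a0 v)))[h|/mono_sub_const]; last by right.
  by left; apply: (mono_sub_line vv).
have: two_color_bound (n1 + n2) p.+1 q by apply: two_color_bound_le.
move=> /(_ _ (isx (plug a0 v)))[/mono_sub_const|h]; first by left.
by right; apply: (mono_sub_line vv).
Qed.

(** The words [w] with a blank are the lines over [A], and [point (enlarge s) w]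
    runs over the lines contained in the subspace [s]. *)
Theorem Graham_Rothschild_lines (J : finType) : exists I : finType,
  forall c : word I (option A) -> bool, exists s : word I (A + J)%type,
    onto s /\ exists b, forall w, variable w -> c (point (enlarge s) w) = b.
Proof.
have [p [f [g fK gK]]] := chainP J.
have [n Hn] := two_color_boundP p p.
have [I HI] := suffix_ignoring_subspace n bool.
exists I => c; have [s [os iss]] := HI c.
suff [b [t [ot mt]]] : exists b, mono_sub b p (fun w => c (point (enlarge s) w)).
  exists (relabel f (compose s t)); split.
    by apply: onto_relabel; [exists g|apply: onto_compose].
  exists b => w vw; rewrite enlarge_relabel point_relabel.
  have -> : enlarge (compose s t) = compose (enlarge s) (enlarge t).
    by apply/ffunP=> i; rewrite !ffunE; case: (s i) => // j; rewrite ffunE.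
  rewrite point_compose mt //; case/variableP: vw => j wj.
  by apply/variableP; exists (g j); rewrite ffunE gK.
by case: (Hn _ iss) => h; [exists true|exists false].
Qed.

End GrahamRothschild.

Local Open Scope ring_scope.

(** * Averages over finite types *)

Definition mean (R : realFieldType) (T : finType) (f : T -> R) : R :=
  (\sum_x f x) / #|T|%:R.

Section Mean.
Variable R : realFieldType.
Implicit Types (T U : finType).

Lemma eq_mean T (f g : T -> R) : f =1 g -> mean f = mean g.
Proof. by move=> fg; congr (_ / _); apply: eq_bigr. Qed.

Lemma ler_mean T (f g : T -> R) : (forall x, f x <= g x) -> mean f <= mean g.
Proof.
by move=> fg; rewrite ler_wpM2r ?invr_ge0 ?ler0n //; apply: ler_sum.
Qed.

Lemma mean_const T (c : R) (x : T) : mean (fun _ : T => c) = c.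
Proof.
rewrite /mean sumr_const -[X in X / _]mulr_natr mulfK // pnatr_eq0 -lt0n.
by apply/card_gt0P; exists x.
Qed.

Lemma mean_le_const T (f : T -> R) c : 0 <= c -> (forall x, f x <= c) -> mean f <= c.
Proof.
move=> c0 fc; have [T0|/card_gt0P[x _]] := posnP #|T|.
  by rewrite /mean T0 invr0 mulr0.
by rewrite -(mean_const c x); apply: ler_mean.
Qed.

Lemma mean_ge0 T (f : T -> R) : (forall x, 0 <= f x) -> 0 <= mean f.
Proof. by move=> f0; rewrite divr_ge0 ?ler0n //; apply: sumr_ge0. Qed.

Lemma meanD T (f g : T -> R) : mean (fun x => f x + g x) = mean f + mean g.
Proof. by rewrite /mean big_split mulrDl. Qed.

Lemma meanZ T c (f : T -> R) : mean (fun x => c * f x) = c * mean f.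
Proof. by rewrite /mean -mulr_sumr mulrA. Qed.

Lemma meanB T (f g : T -> R) : mean (fun x => f x - g x) = mean f - mean g.
Proof. by rewrite /mean sumrB mulrBl. Qed.

Lemma mean_sum T U (f : T -> U -> R) :
  mean (fun x => \sum_u f x u) = \sum_u mean (fun x => f x u).
Proof. by rewrite /mean exchange_big -mulr_suml. Qed.

Lemma mean_exchange T U (f : T -> U -> R) :
  mean (fun x => mean (f x)) = mean (fun u => mean (fun x => f x u)).
Proof. by rewrite /mean -!mulr_suml exchange_big -!mulrA [_^-1 * _]mulrC. Qed.

Lemma mean_pair T U (f : T * U -> R) :
  mean f = mean (fun x => mean (fun u => f (x, u))).
Proof.
by rewrite /mean -mulr_suml pair_bigA card_prod natrM invfM -mulrA [_^-1 * _]mulrC;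
  congr (_ * _); apply: eq_bigr => -[].
Qed.

Lemma mean_bij T U (h : T -> U) (f : U -> R) : bijective h ->
  mean f = mean (fun x => f (h x)).
Proof.
move=> hb; rewrite /mean (bij_eq_card hb); congr (_ / _).
by apply: reindex; apply: onW_bij.
Qed.

Lemma mean_unit (f : unit -> R) : mean f = f tt.
Proof.
by rewrite -[RHS](mean_const _ tt); apply: eq_mean => -[].
Qed.

Lemma exists_ge_mean T (f : T -> R) c : 0 < c -> c <= mean f -> exists x, c <= f x.
Proof.
move=> c0 cf; have [T0|/card_gt0P[x0 _]] := posnP #|T|.
  by move: cf; rewrite /mean T0 invr0 mulr0 leNgt c0.
have [/existsP//|] := boolP [exists x, c <= f x].
rewrite negb_exists => /forallP h; suff: mean f < c by rewrite ltNge cf.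
have T0 : (0 < #|T|)%N by apply/card_gt0P; exists x0.
rewrite /mean ltr_pdivrMr ?ltr0n // mulr_natr -sumr_const; apply: ltr_sum.
  by apply/hasP; exists x0; rewrite ?mem_index_enum.
by move=> x _; rewrite ltNge.
Qed.

Lemma mean_word_cat (I J A : finType) (f : word (I + J)%type A -> R) :
  mean f = mean (fun x => mean (fun y => f (wcat x y))).
Proof.
rewrite (mean_bij (h := fun p : word I A * word J A => wcat p.1 p.2) f).
  exact: mean_pair.
exists (fun w : word (I + J)%type A =>
  ([ffun i => w (inl i)] : word I A, [ffun j => w (inr j)] : word J A)).
  by move=> [x y]; congr pair; apply/ffunP=> i; rewrite !ffunE.
by move=> w; apply/ffunP=> -[i|j]; rewrite !ffunE.
Qed.

(** If every fibre of density at least [delta / 2] contains one of finitely many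
    configurations, one configuration is contained in a positive proportion of
    the fibres: at least [delta / 2] of them, in measure, are dense, and each
    dense fibre chooses among [#|L|] configurations. *)
Lemma common_hit (X Y L : finType) (hit : L -> (X -> bool) -> bool)
    (delta : R) (D : X -> Y -> bool) : 0 < delta ->
  (forall y, delta / 2 <= mean (fun x => (D x y)%:R : R) ->
     exists l, hit l (fun x => D x y)) ->
  delta <= mean (fun y => mean (fun x => (D x y)%:R : R)) ->
  exists l, delta / 2 / #|L|%:R <= mean (fun y => (hit l (fun x => D x y))%:R : R).
Proof.
move=> d0 H dD.
have h : delta / 2 <= \sum_l mean (fun y => (hit l (fun x => D x y))%:R : R).
  rewrite -mean_sum.
  suff : delta <= delta / 2 +
      mean (fun y => \sum_l (hit l (fun x => D x y))%:R) by lra.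
  apply: (le_trans dD).
  apply: (@le_trans _ _ (mean (fun y => delta / 2 + \sum_l (hit l (fun x => D x y))%:R))).
    apply: ler_mean => y; have [hy|hy] := ltrP (mean (fun x => (D x y)%:R : R)) (delta / 2).
      by rewrite (le_trans (ltW hy)) // lerDl sumr_ge0 // => l _; rewrite ler0n.
    have [l hl] := H _ hy; rewrite (bigD1 l) //= hl.
    apply: (@le_trans _ _ 1).
      by apply: mean_le_const => // x; case: (D x y).
    have : 0 <= \sum_(i | i != l) (hit i (fun x => D x y))%:R :> R.
      by apply: sumr_ge0 => i _; rewrite ler0n.
    by move: d0; set S := \sum_(i | _) _; rewrite /= => *; lra.
  by rewrite meanD lerD2r; apply: mean_le_const => //; lra.
have [L0|/card_gt0P[l0 _]] := posnP #|L|.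
  move: h; rewrite big1; first by rewrite leNgt => /negP[]; lra.
  by move=> l; have := fintype0 l; rewrite L0.
have [l hl] : exists l, delta / 2 / #|L|%:R <=
    mean (fun y => (hit l (fun x => D x y))%:R : R); last by exists l.
have := @exists_ge_mean L (fun l => mean (fun y => (hit l (fun x => D x y))%:R : R))
  (delta / 2 / #|L|%:R); apply.
  by rewrite !divr_gt0 ?ltr0n //; apply/card_gt0P; exists l0.
by rewrite ler_wpM2r ?invr_ge0 ?ler0n.
Qed.

End Mean.

(** * Density Hales-Jewett for a fixed alphabet *)

Section DHJ.
Variable R : realFieldType.

Definition DHJ_at (A : finType) (delta : R) (I : finType) :=
  forall D : word I A -> bool, delta <= mean (fun w => (D w)%:R : R) ->
  exists v : word I (option A), variable v /\ forall a, D (plug a v).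

Definition DHJ (A : finType) (delta : R) := exists I, DHJ_at A delta I.

Lemma DHJ_le (A : finType) (d e : R) : d <= e -> DHJ A d -> DHJ A e.
Proof. by move=> de [I HI]; exists I => D eD; apply: HI; apply: le_trans eD. Qed.

Definition contains_line (I A : finType) (v : word I (option A)) (D : word I A -> bool) :=
  variable v && [forall a, D (plug a v)].

Lemma common_line (A : finType) (delta : R) (I Y : finType)
    (D : word I A -> Y -> bool) :
  0 < delta -> DHJ_at A (delta / 2) I ->
  delta <= mean (fun y => mean (fun w => (D w y)%:R : R)) ->
  exists v, variable v /\
    delta / 2 / #|word I (option A)|%:R <=
    mean (fun y => [forall a, D (plug a v) y]%:R : R).
Proof.
move=> d0 HI dD.
have [y|v] := common_hit (hit := @contains_line I A) d0 _ dD.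
  by case/HI=> v [vv hv]; exists v; rewrite /contains_line vv; apply/forallP.
rewrite /contains_line; have [vv|vv] := boolP (variable v); first by exists v.
move=> h; exfalso; move: h; rewrite /= (_ : mean _ = 0); last first.
  by rewrite /mean big1 ?mul0r.
rewrite leNgt => /negP[]; rewrite !divr_gt0 ?ltr0n //.
by apply/card_gt0P; exists v.
Qed.

(** A line common to many fibres gives the first parameter; the suffixes for which
    it is contained in [D] form a dense set, to which induction applies. *)
Theorem multidimensional_DHJ (A J : finType) :
  (forall d, 0 < d -> DHJ A d) -> forall d, 0 < d ->
  exists I : finType, forall D : word I A -> bool,
    d <= mean (fun w => (D w)%:R : R) ->
  exists s : word I (A + J)%type, onto s /\ forall w, D (point s w).
Proof.
move=> HA; elim/finType_ind: J => [J K f fbij IH||J IH] d d0.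
- have [I HI] := IH d d0; exists I => D /HI[s [os sD]].
  by exists (relabel f s); split=> [|w]; rewrite ?point_relabel //; apply: onto_relabel.
- exists void => D dD; exists [ffun x : void => match x with end]; split.
    by apply/ontoP=> -[].
  move=> w; have [x] := exists_ge_mean d0 dD.
  case E: (D x) => dx; last by move: dx; rewrite leNgt d0.
  by rewrite (_ : point _ _ = x) //; apply/ffunP=> -[].
have [I1 HI1] := HA (d / 2) ltac:(lra).
have [I2 HI2] := IH (d / 2 / (#|word I1 (option A)|.+1)%:R)
  ltac:(by rewrite !divr_gt0 ?ltr0n).
exists (I1 + I2)%type => D; rewrite mean_word_cat mean_exchange => dD.
have [v [vv hv]] := common_line (D := fun x y => D (wcat x y)) d0 HI1 dD.
have [|s [os sD]] := HI2 (fun y => [forall a, D (wcat (plug a v) y)]).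
  apply: le_trans hv; rewrite ler_wpM2l //; first by lra.
  rewrite lef_pV2 ?posrE ?ltr0n ?ler_nat //.
  by apply/card_gt0P; exists v.
exists (wcat (line_sub J v) (relabel Some s)); split; first exact: onto_line_cat.
by move=> w; rewrite point_wcat point_line_sub point_relabel; apply/forallP: (w None).
Qed.

(** * Insensitive sets *)

(** A set is invariant under exchanging [None] and [a] in any coordinates when
    membership depends only on the word with each [None] replaced by [a]. *)
Definition insensitive (A I : finType) (a : A) (P : word I (option A) -> bool) :=
  forall w, P w = P (wsome (plug a w)).

Lemma insensitive_point (A I J : finType) (a : A) (P : word I (option A) -> bool)
    (s : word I (option A + J)%type) :
  insensitive a P -> insensitive a (fun w => P (point s w)).
Proof. by move=> hP w; rewrite hP -plug_point_plug -hP. Qed.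

Definition fix_left (I J : finType) (A : Type) (x : word I A) :
  word (I + J)%type (A + J)%type :=
  wcat [ffun i => inl (x i)] [ffun j => inr j].

Definition fix_right (I J K : finType) (A : Type) (s : word I (A + J)%type) (y : word K A) :
  word (I + K)%type (A + J)%type :=
  wcat s [ffun k => inl (y k)].

Lemma point_fix_left (I J : finType) (A : Type) (x : word I A) (y : word J A) :
  point (fix_left J x) y = wcat x y.
Proof. by apply/ffunP=> -[i|j]; rewrite !ffunE. Qed.

Lemma onto_fix_left (I J A : finType) (x : word I A) : onto (fix_left J x).
Proof. by apply/ontoP=> j; exists (inr j); rewrite !ffunE. Qed.

Lemma point_fix_right (I J K : finType) (A : Type) (s : word I (A + J)%type)
  (y : word K A) w : point (fix_right s y) w = wcat (point s w) y.
Proof. by apply/ffunP=> -[i|j]; rewrite !ffunE. Qed.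

Lemma onto_fix_right (I J K A : finType) (s : word I (A + J)%type) (y : word K A) :
  onto s -> onto (fix_right s y).
Proof.
by move=> /ontoP os; apply/ontoP=> j; have [i si] := os j; exists (inl i); rewrite !ffunE.
Qed.

Lemma insensitive_wcatl (A I J : finType) (a : A) (P : word (I + J)%type (option A) -> bool) x :
  insensitive a P -> insensitive a (fun y => P (wcat x y)).
Proof. by move=> hP w; have := insensitive_point (fix_left J x) hP w; rewrite !point_fix_left. Qed.

Lemma insensitive_wcatr (A I J : finType) (a : A) (P : word (I + J)%type (option A) -> bool) y :
  insensitive a P -> insensitive a (fun x => P (wcat x y)).
Proof.
move=> hP w; pose s : word I (option A + I)%type := [ffun i => inr i].
have E z : point s z = z by apply/ffunP=> i; rewrite !ffunE.
by have := insensitive_point (fix_right s y) hP w; rewrite !point_fix_right !E.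
Qed.

End DHJ.

Lemma exists_expr_lt (R : archiRealFieldType) (q e : R) : 0 <= q -> q < 1 -> 0 < e ->
  exists n, q ^+ n < e.
Proof.
move=> q0 q1 e0; have [->|qn0] := eqVneq q 0; first by exists 1%N; rewrite expr1.
have qp : 0 < q by rewrite lt_def qn0.
pose h := q^-1 - 1; have h0 : 0 < h by rewrite subr_gt0 invf_gt1.
have bern n : 1 + h *+ n <= (1 + h) ^+ n.
  elim: n => [|n IH]; first by rewrite expr0 mulr0n addr0.
  rewrite exprS mulrS; have : 0 <= h *+ n by rewrite mulrn_wge0 // ltW.
  by move: (h *+ n) ((1 + h) ^+ n) IH => z t; nra.
pose n := Num.bound (e^-1 / h).
have hn : e^-1 / h < n%:R by apply: archi_boundP; rewrite divr_ge0 ?invr_ge0 ?ltW.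
exists n; rewrite -ltf_pV2 ?posrE ?exprn_gt0 // -exprVn.
have -> : q^-1 = 1 + h by rewrite /h addrC subrK.
apply: lt_le_trans (bern n); rewrite -mulr_natr.
by move: hn; rewrite ltr_pdivrMr // => ?; lra.
Qed.

Section Insensitive.
Variables (R : archiRealFieldType) (A : finType) (a0 : A).
Hypothesis DHJ_A : forall d : R, 0 < d -> DHJ A d.

Definition contains_sub (I J B : finType) (s : word I (B + J)%type) (D : word I B -> bool) :=
  onto s && [forall w, D (point s w)].

Lemma contains_subP (I J B : finType) (s : word I (B + J)%type) (D : word I B -> bool) :
  reflect (onto s /\ forall w, D (point s w)) (contains_sub s D).
Proof. by apply: (iffP andP) => -[? /forallP]. Qed.

Lemma mean_wsome (I : finType) (f : word I (option A) -> R) :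
  mean (fun w => (~~ variable w)%:R * f w) =
  mean (fun w : word I (option A) => (~~ variable w)%:R : R) *
  mean (fun x : word I A => f (wsome x)).
Proof.
pose h (x : word I A) := wsome x.
have key (g : word I (option A) -> R) :
    \sum_w (~~ variable w)%:R * g w = \sum_x g (h x).
  transitivity (\sum_(w | ~~ variable w) g w).
    by rewrite [RHS]big_mkcond; apply: eq_bigr => w _; case: ifP; rewrite ?mul1r ?mul0r.
  rewrite (reindex h); last first.
    exists (plug a0) => [x _|w]; first exact: plug_wsome.
    by rewrite inE => vw; rewrite /h -nonvariable.
  apply: eq_bigl => x; apply/negP => /variableP[i]; by rewrite ffunE.
have k1 := key (fun=> 1); rewrite sumr_const in k1.
have N0 : (#|word I A|%:R : R) != 0.
  by rewrite pnatr_eq0 -lt0n; apply/card_gt0P; exists [ffun=> a0].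
rewrite /mean key.
under [X in X / _ * _]eq_bigr => w _ do rewrite -[_%:R]mulr1.
rewrite k1 -/h; move: N0; set N := _%:R; set M := _%:R; set S := \sum_x _ => N0.
by rewrite mulrAC [N * _]mulrC divfK.
Qed.

(** An insensitive set without [J]-subspaces is sparse. If a block of coordinates
    avoids [None], the fibre over the other coordinates has density at most [e]
    among the words over [A]: a subspace over [A] inside it, allowed to take the
    value [None] as well, would stay inside by insensitivity. Among [N] blocks,
    the proportion of words in which every block contains [None] is [q ^+ N]. *)
Lemma insensitive_sparse (J : finType) (e : R) : 0 < e ->
  exists2 q : R, 0 <= q < 1 & forall N, exists M : finType,
  forall (a : A) (P : word M (option A) -> bool), insensitive a P ->
  (forall s : word M (option A + J)%type, ~~ contains_sub s P) ->
  mean (fun w => (P w)%:R) <= e + q ^+ N.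
Proof.
move=> e0; have [I0 H0] := multidimensional_DHJ J DHJ_A e0.
pose p := mean (fun w : word I0 (option A) => (~~ variable w)%:R : R).
have p0 : 0 < p.
  rewrite divr_gt0 ?ltr0n //; last by apply/card_gt0P; exists [ffun=> None].
  rewrite (bigD1 (wsome [ffun=> a0])) //= ltr_pwDl ?sumr_ge0 //.
  by rewrite (_ : variable _ = false) //; apply/negbTE/negP=> /variableP[i]; rewrite ffunE.
have p1 : p <= 1 by apply: mean_le_const => // w; case: (~~ _).
exists (1 - p); first by apply/andP; lra.
elim=> [|N [M HM]].
  exists void => a P _ _; apply: mean_le_const => [|w]; rewrite expr0; first by lra.
  by case: (P w); rewrite /=; lra.
exists (I0 + M)%type => a P hP noP.
set t := e + (1 - p) ^+ N.
have -> : e + (1 - p) ^+ N.+1 = p * e + (1 - p) * t by rewrite /t exprS; lra.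
rewrite mean_word_cat.
pose g x := mean (fun y => (P (wcat x y))%:R : R).
have gvar x : g x <= t.
  apply: (HM a); first exact: insensitive_wcatl.
  move=> s; apply/contains_subP=> -[os sP].
  have /contains_subP[] := noP (compose (fix_left M x) s).
  split=> [|w]; first by apply: onto_compose => //; apply: onto_fix_left.
  by rewrite point_compose point_fix_left.
have gconst : mean (fun x : word I0 A => g (wsome x)) <= e.
  rewrite /g mean_exchange; apply: mean_le_const => [|y]; first exact: ltW.
  rewrite leNgt; apply/negP => /ltW/(H0 (fun x => P (wcat (wsome x) y)))[s [os sP]].
  have /contains_subP[] := noP (fix_right (enlarge s) y).
  split=> [|w]; first by apply: onto_fix_right; apply: onto_enlarge.
  rewrite point_fix_right.
  have /(_ (point (enlarge s) w)) -> := insensitive_wcatr y hP.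
  by rewrite plug_point sP.
apply: (@le_trans _ _ (mean (fun x => (~~ variable x)%:R * g x + (1 - (~~ variable x)%:R) * t))).
  by apply: ler_mean => x; have := gvar x; rewrite -/(g x); case: variable => /=; lra.
rewrite meanD mean_wsome -/p; apply: lerD; first by rewrite ler_wpM2l // ltW.
rewrite (eq_mean (g := fun x => t * (1 - (~~ variable x)%:R))); last by move=> x; rewrite mulrC.
rewrite meanZ meanB (mean_const _ [ffun=> None]) -/p; lra.
Qed.

Lemma insensitive_dense (J : finType) (e : R) : 0 < e -> exists M : finType,
  forall (a : A) (P : word M (option A) -> bool), insensitive a P ->
  e <= mean (fun w => (P w)%:R : R) ->
  exists s : word M (option A + J)%type, contains_sub s P.
Proof.
move=> e0; have [|q /andP[q0 q1] H] := @insensitive_sparse J (e / 2); first by lra.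
have [N hN] := @exists_expr_lt R q (e / 2) q0 q1 ltac:(lra).
have [M HM] := H N; exists M => a P hP eP.
have [/existsP//|] := boolP [exists s : word M (option A + J)%type, contains_sub s P].
by rewrite negb_exists => /forallP noP; have := HM a P hP noP; lra.
Qed.

Lemma point_inj (I J B : finType) (s : word I (B + J)%type) : onto s -> injective (point s).
Proof.
move=> /ontoP os w w' E; apply/ffunP=> j; have [i si] := os j.
by have /ffunP/(_ i) := E; rewrite !ffunE si.
Qed.

(** Up to density [e], an insensitive set is a disjoint union of [J]-subspaces.
    This is stated dually: a weight [f] of nonpositive mean on every subspace
    contained in the set has mean at most [e] on the set, which avoids handling
    the partition itself. The set varies in a family [X] because removing
    [V * T], where the fixed subspace [V] is contained in the fibres over [T],
    destroys insensitivity in the coordinates of [V]; these coordinates are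
    moved into the index of the family. *)
Lemma insensitive_exhaust (J : finType) (e : R) : 0 < e -> exists M : finType,
  forall (a : A) (X : finType) (P : X -> word M (option A) -> bool)
    (f : X -> word M (option A) -> R),
  (forall x, insensitive a (P x)) -> (forall x w, f x w <= 1) ->
  (forall x (s : word M (option A + J)%type), contains_sub s (P x) ->
     mean (fun w => f x (point s w)) <= 0) ->
  mean (fun x => mean (fun w => (P x w)%:R * f x w)) <= e.
Proof.
move=> e0; have [e1|e1] := lerP 1 e.
  exists void => a X P f _ f1 _; apply: (le_trans _ e1).
  apply: mean_le_const => // x; apply: mean_le_const => // w.
  by case: (P x w); rewrite ?mul0r ?mul1r.
have [M0 H0] := @insensitive_dense J (e / 2) ltac:(lra).
pose eta := e / 2 / #|word M0 (option A + J)%type|%:R / #|word M0 (option A)|%:R.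
have [L0|/card_gt0P[s0 _]] := posnP #|word M0 (option A + J)%type|.
  have [s] := H0 a0 xpredT (fun=> erefl) ltac:(rewrite /= (mean_const _ [ffun=> None]); lra).
  by have := fintype0 s; rewrite L0.
have eta0 : 0 < eta.
  rewrite !divr_gt0 ?ltr0n //; first by apply/card_gt0P; exists s0.
  by apply/card_gt0P; exists [ffun=> None].
(* Each removal lowers the density by [eta]; hence the induction on the number
   [n] of removals that exhaust the density above [e]. *)
suff rec n : exists M : finType,
  forall (a : A) (X : finType) (P : X -> word M (option A) -> bool)
    (f : X -> word M (option A) -> R),
  (forall x, insensitive a (P x)) -> (forall x w, f x w <= 1) ->
  (forall x (s : word M (option A + J)%type), contains_sub s (P x) ->
     mean (fun w => f x (point s w)) <= 0) ->
  mean (fun x => mean (fun w => (P x w)%:R)) <= e + eta *+ n ->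
  mean (fun x => mean (fun w => (P x w)%:R * f x w)) <= e.
  pose n := Num.bound (eta^-1).
  have hn : eta^-1 < n%:R by apply: archi_boundP; rewrite invr_ge0 ltW.
  have hn1 : 1 <= eta *+ n.
    by rewrite -mulr_natl -ler_pdivrMr // div1r ltW.
  have [M HM] := rec n; exists M => a X P f hP f1 hf; apply: (HM a) => //.
  apply: (@le_trans _ _ 1); last by lra.
  by apply: mean_le_const => // x; apply: mean_le_const => // w; case: (P x w).
have small (M : finType) (X : finType) (P : X -> word M (option A) -> bool)
    (f : X -> word M (option A) -> R) : (forall x w, f x w <= 1) ->
    mean (fun x => mean (fun w => (P x w)%:R)) <= e ->
    mean (fun x => mean (fun w => (P x w)%:R * f x w)) <= e.
  move=> f1; apply: le_trans; apply: ler_mean => x; apply: ler_mean => w.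
  by case: (P x w) => /=; rewrite ?mul0r // mul1r.
elim: n => [|n [M HM]].
  by exists void => a X P f _ f1 _; rewrite mulr0n addr0; apply: small.
exists (M0 + M)%type => a X P f hP f1 hf hn.
have [|/ltW big] := lerP (mean (fun x => mean (fun w => (P x w)%:R : R))) e; first exact: small.
have [||s hs] := @common_hit R _ (X * word M (option A))%type _ (@contains_sub M0 J (option A)) e
   (fun u p => P p.1 (wcat u p.2)) e0.
- by move=> -[x y]; apply: H0; apply: insensitive_wcatr.
- rewrite mean_pair; apply: le_trans big _; apply: ler_mean => x.
  by rewrite mean_word_cat mean_exchange.
have os : onto s.
  apply/negPn/negP => ns; move: hs.
  rewrite (_ : mean _ = 0); last first.
    by rewrite /mean big1 ?mul0r // => p _; rewrite /contains_sub (negbTE ns).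
  by rewrite leNgt => /negP[]; rewrite !divr_gt0 ?ltr0n //; apply/card_gt0P; exists s0.
pose T x y := contains_sub s (fun u => P x (wcat u y)).
pose V u := [exists w, point s w == u].
have sumV (g : word M0 (option A) -> R) : \sum_u (V u)%:R * g u = \sum_w g (point s w).
  have VE u : (V u)%:R = \sum_w (point s w == u)%:R :> R.
    rewrite /V; case: existsP => [[w /eqP wu]|nw].
      rewrite (bigD1 w) //= wu eqxx big1 ?addr0 // => w' nww'.
      by apply/eqP; rewrite pnatr_eq0 eqb0 -wu (inj_eq (point_inj os)).
    by rewrite big1 // => w _; case: eqP => // wu; case: nw; exists w; apply/eqP.
  under eq_bigr => u _ do rewrite VE mulr_suml.
  rewrite exchange_big; apply: eq_bigr => w _.
  rewrite (bigD1 (point s w)) //= eqxx mul1r big1 ?addr0 // => u nu.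
  by rewrite eq_sym (negbTE nu) mul0r.
(* [P'] is what remains, with the prefix [u] moved to the index. *)
pose P' (p : X * word M0 (option A)) y := P p.1 (wcat p.2 y) && ~~ (V p.2 && T p.1 y).
pose f' (p : X * word M0 (option A)) y := f p.1 (wcat p.2 y).
have TP x u y : V u -> T x y -> P x (wcat u y).
  by move=> /existsP[w /eqP <-] /contains_subP[_]; apply.
have split_mean (g : X -> word (M0 + M)%type (option A) -> R) :
    mean (fun x => mean (fun w => (P x w)%:R * g x w)) =
    mean (fun p => mean (fun y => (P' p y)%:R * g p.1 (wcat p.2 y))) +
    mean (fun x => mean (fun y => (T x y)%:R * mean (fun u => (V u)%:R * g x (wcat u y)))).
  rewrite mean_pair -meanD; apply: eq_mean => x.
  rewrite mean_word_cat mean_exchange [X in X + _]mean_exchange -meanD; apply: eq_mean => y.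
  rewrite -meanZ -meanD; apply: eq_mean => u; rewrite /P' /=.
  have := @TP x u y; case: (V u); case: (T x y) => h;
    first (rewrite h //); rewrite /= ?andbT ?mul0r ?mul1r ?addr0 ?add0r //.
rewrite split_mean.
apply: (@le_trans _ _ (e + 0)); last by rewrite addr0.
apply: lerD.
  apply: (HM a _ P' f').
  - move=> [x u] w; rewrite /P' /=.
    have /(_ w) <- := insensitive_wcatl u (hP x).
    congr (_ && ~~ (_ && _)); rewrite /T /contains_sub; congr (_ && _).
    by apply: eq_forallb => z; have /(_ w) <- := insensitive_wcatl (point s z) (hP x).
  - by move=> [x u] w; apply: f1.
  - move=> [x u] t /contains_subP[ot tP].
    rewrite (eq_mean (g := fun w => f x (point (compose (fix_left M u) t) w))); last first.
      by move=> w; rewrite point_compose point_fix_left.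
    apply: hf; apply/contains_subP; split.
      by apply: onto_compose => //; apply: onto_fix_left.
    by move=> w; rewrite point_compose point_fix_left; have /andP[] := tP w.
  have := split_mean (fun _ _ => 1).
  rewrite (_ : mean (fun x => mean (fun w => (P x w)%:R * 1)) =
      mean (fun x => mean (fun w => (P x w)%:R))); last first.
    by apply: eq_mean => x; apply: eq_mean => w; rewrite mulr1.
  rewrite (_ : mean (fun p => mean (fun y => (P' p y)%:R * 1)) =
      mean (fun p => mean (fun y => (P' p y)%:R))); last first.
    by apply: eq_mean => x; apply: eq_mean => w; rewrite mulr1.
  suff : eta <= mean (fun x => mean (fun y => (T x y)%:R * mean (fun u => (V u)%:R * 1))).
    by move: hn; rewrite mulrSr; lra.
  pose v := mean (fun u => (V u)%:R * 1 : R).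
  have -> : mean (fun x => mean (fun y => (T x y)%:R * v)) =
      v * mean (fun p => (T p.1 p.2)%:R).
    by rewrite mean_pair -meanZ; apply: eq_mean => x; rewrite -meanZ;
      apply: eq_mean => y; rewrite mulrC.
  rewrite /eta mulrC; apply: ler_pM.
  - by rewrite invr_ge0 ler0n.
  - by rewrite !divr_ge0 ?ler0n // ltW.
  - rewrite /v /mean sumV sumr_const -[X in X <= _]mul1r ler_wpM2r ?invr_ge0 ?ler0n //.
    by rewrite ler1n; apply/card_gt0P; exists [ffun=> None].
  - by rewrite mean_pair in hs *.
apply: mean_le_const => // x; apply: mean_le_const => // y.
case: (boolP (T x y)) => [/contains_subP[_ Ty]|_]; last by rewrite mul0r.
rewrite mul1r /mean sumV.
have h := hf x (fix_right s y); rewrite pmulr_lle0 ?invr_gt0 ?ltr0n; last first.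
  by apply/card_gt0P; exists [ffun=> None].
have : mean (fun w => f x (point (fix_right s y) w)) <= 0.
  apply: h; apply/contains_subP; split; first exact: onto_fix_right.
  by move=> w; rewrite point_fix_right.
rewrite /mean pmulr_lle0 ?invr_gt0 ?ltr0n; last first.
  by apply/card_gt0P; exists [ffun=> None].
by under eq_bigr => w _ do rewrite point_fix_right.
Qed.

(** The partition for the first letter has pieces of large dimension [J1]; in each
    piece the trace of the remaining sets is again insensitive, and the piece is
    partitioned further. The constant [e / 2] subtracted from [f] absorbs the
    error inside the pieces. *)
Lemma insensitive_exhaust_seq (S : seq A) (J : finType) (e : R) : 0 < e -> exists M : finType,
  forall (X : finType) (P : A -> X -> word M (option A) -> bool)
    (f : X -> word M (option A) -> R),
  (forall a x, insensitive a (P a x)) -> (forall x w, f x w <= 1) ->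
  (forall x (s : word M (option A + J)%type),
     contains_sub s (fun w => all (fun a => P a x w) S) ->
     mean (fun w => f x (point s w)) <= 0) ->
  mean (fun x => mean (fun w => (all (fun a => P a x w) S)%:R * f x w)) <= e.
Proof.
elim: S e => [|a S IH] e e0.
  (* Without constraints the subspace of all words is the only piece. *)
  exists J => X P f _ _ hf; apply: mean_le_const => [|x]; first exact: ltW.
  apply: le_trans (ltW e0).
  pose s : word J (option A + J)%type := [ffun j => inr j].
  rewrite (eq_mean (g := fun w => f x (point s w))); last first.
    by move=> w; rewrite /= mul1r; congr (f x); apply/ffunP=> j; rewrite !ffunE.
  apply: hf; apply/contains_subP; split=> //.
  by apply/ontoP=> j; exists j; rewrite ffunE.
have [J1 H1] := IH (e / 2) ltac:(lra).
have [M HM] := @insensitive_exhaust J1 (e / 2) ltac:(lra).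
exists M => X P f hP f1 hf.
pose Q x w := all (fun b => P b x w) S.
pose f' x w := (Q x w)%:R * f x w - e / 2.
have : mean (fun x => mean (fun w => (P a x w)%:R * f' x w)) <= e / 2.
  apply: (HM a) => //.
    by move=> x w; rewrite /f'; have := f1 x w; case: (Q x w) => /=; lra.
  move=> x s /contains_subP[os sP].
  rewrite meanB (mean_const _ [ffun=> None]) subr_le0.
  have := H1 unit (fun b _ w => P b x (point s w)) (fun _ w => f x (point s w)).
  rewrite mean_unit; apply=> [b _|_ w|_ t /contains_subP[ot tP]] //.
  - exact: (insensitive_point s (hP b x)).
  - rewrite (eq_mean (g := fun w => f x (point (compose s t) w))); last first.
      by move=> w; rewrite point_compose.
    apply: hf; apply/contains_subP; split; first exact: onto_compose.
    by move=> w; rewrite /= point_compose sP; apply: tP.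
move=> le2; rewrite [e]splitr.
apply: (@le_trans _ _ (mean (fun x => mean (fun w => (P a x w)%:R * f' x w) + e / 2))).
  apply: ler_mean => x.
  apply: (@le_trans _ _ (mean (fun w => (P a x w)%:R * f' x w + e / 2))).
    apply: ler_mean => w; rewrite /f' -/(Q x w) /=.
    by case: (P a x w); rewrite /= ?mul1r ?mul0r ?add0r ?subrK // divr_ge0 // ltW.
  by rewrite meanD lerD2l; apply: mean_le_const => //; rewrite divr_ge0 // ltW.
rewrite meanD; apply: lerD => //.
by apply: mean_le_const => //; rewrite divr_ge0 // ltW.
Qed.

End Insensitive.

(** * Adding a letter to the alphabet *)

Lemma variable_wcat (I J A : finType) (x : word I (option A)) (y : word J (option A)) :
  variable (wcat x y) = variable x || variable y.
Proof.
apply/idP/orP => [|[]]; [|exact: variable_wcatl|exact: variable_wcatr].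
by move=> /variableP[[i|j]]; rewrite ffunE => h; [left|right]; apply/variableP; eexists; apply: h.
Qed.

Lemma rare_constant (R : archiRealFieldType) (A : finType) (e : R) : 0 < e ->
  exists K : finType, mean (fun w : word K (option A) => (~~ variable w)%:R) <= e.
Proof.
move=> e0; pose q := mean (fun w : word unit (option A) => (~~ variable w)%:R : R).
have q0 : 0 <= q by apply: mean_ge0 => w; rewrite ler0n.
have q1 : q < 1.
  rewrite ltr_pdivrMr ?mul1r ?ltr0n; last by apply/card_gt0P; exists [ffun=> None].
  rewrite -sumr_const.
  rewrite (bigD1 [ffun=> None]) //= [ltRHS](bigD1 [ffun=> None]) //=.
  apply: ltr_leD; last by apply: ler_sum => w _; case: (~~ _).
  by rewrite (_ : variable _) //; apply/variableP; exists tt; rewrite ffunE.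
have [n hn] := exists_expr_lt q0 q1 e0.
suff [K hK] : exists K : finType, mean (fun w : word K (option A) => (~~ variable w)%:R) <= q ^+ n.
  by exists K; apply: le_trans (ltW hn).
elim: n {hn} => [|n [K IH]].
  by exists void; apply: mean_le_const => // w; case: (~~ _).
exists (unit + K)%type; rewrite mean_word_cat exprS.
rewrite (eq_mean (g := fun x => mean (fun w : word K (option A) => (~~ variable w)%:R) *
  (~~ variable x)%:R)).
  by rewrite meanZ mulrC; apply: ler_wpM2l.
move=> x; rewrite mulrC -meanZ; apply: eq_mean => y.
by rewrite variable_wcat negb_or -mulnb natrM.
Qed.

(** Values bounded by [d + e] with mean at least [d - e] are all close to [d], with
    an error that involves the number of points. *)
Lemma point_lower_bound (R : realFieldType) (T : finType) (f : T -> R) (d e : R) (x : T) :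
  (forall y, f y <= d + e) -> d - e <= mean f -> d - 2 * e * #|T|%:R <= f x.
Proof.
move=> fle dm; have T0 : (0 : R) < #|T|%:R by rewrite ltr0n; apply/card_gt0P; exists x.
have e0 : 0 <= e.
  by have : mean f <= d + e; [rewrite -(mean_const (d + e) x); exact: ler_mean|lra].
have h : #|T|%:R * (d - e) <= \sum_y f y by move: dm; rewrite ler_pdivlMr // mulrC.
have : \sum_y f y <= f x + (#|T|%:R - 1) * (d + e).
  rewrite (bigD1 x) //= lerD2l.
  apply: le_trans (ler_sum _ (fun y _ => fle y)) _.
  have : \sum_(y : T) (d + e) = (d + e) + \sum_(y | y != x) (d + e) by exact: bigD1.
  by rewrite sumr_const -[X in X = _]mulr_natl; move: (\sum_(y | _) _) => s; lra.
by move: h T0; move: (\sum_y _) (#|T|%:R) (f x) => s n u; nra.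
Qed.

(** The complement of an intersection is the disjoint union of the other atoms of
    the generated algebra. *)
Lemma sum_pattern (R : realFieldType) (A : finType) (C : A -> bool) (r : R) :
  \sum_(S : {ffun A -> bool} | S != [ffun=> true])
    (all (fun a => C a == S a) (enum A))%:R * r = (~~ [forall a, C a])%:R * r.
Proof.
pose S0 := [ffun a => C a].
have E (S : {ffun A -> bool}) : all (fun a => C a == S a) (enum A) = (S == S0).
  apply/allP/eqP => [h|-> a _]; last by rewrite ffunE.
  by apply/ffunP=> a; rewrite ffunE; apply/esym/eqP/h; rewrite mem_enum.
rewrite (eq_bigr (fun S => if S == S0 then r else 0)); last first.
  by move=> S _; rewrite E; case: eqP; rewrite ?mul1r ?mul0r.
rewrite -big_mkcondr /=.
have -> : [forall a, C a] = (S0 == [ffun=> true]).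
  apply/forallP/eqP => [h|/ffunP h a]; first by apply/ffunP=> a; rewrite !ffunE h.
  by have := h a; rewrite !ffunE.
have [S0T|S0T] := eqVneq S0 [ffun=> true].
  by rewrite mul0r big1 // => S; rewrite -S0T => /andP[/negbTE ->].
rewrite mul1r (bigD1 S0) ?S0T ?eqxx //= big1 ?addr0 // => S.
by case/andP=> /andP[_ /eqP ->]; rewrite eqxx.
Qed.

Section Step.
Variables (R : archiRealFieldType) (A : finType) (a0 : A).
Hypothesis DHJ_A : forall d : R, 0 < d -> DHJ A d.

Lemma line_in_sub (B I J : finType) (D : word I B -> bool) (s : word I (B + J)%type)
    (v : word J (option B)) : onto s -> variable v ->
  (forall b, D (point s (plug b v))) ->
  exists v, variable v /\ forall b, D (plug b v).
Proof.
move=> os vv Dv; exists (point (enlarge s) v); split; first exact: variable_point.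
by move=> b; rewrite plug_point.
Qed.

Lemma increment_contradiction (d th z m : R) : 0 < d -> 0 < th -> z = d * th / 16 ->
  th / 2 <= m -> d - z <= z + z + (d + z) * (1 - m) -> False.
Proof.
move=> d0 t0 zE hm; have : d * th / 2 <= d * m by rewrite -mulrA ler_wpM2l // ltW.
have : 0 < d * th by rewrite mulr_gt0.
have z0 : 0 < z by rewrite zE divr_gt0 ?mulr_gt0.
have : 0 <= z * m by rewrite mulr_ge0 ?ltW //; lra.
by rewrite mulrBr mulr1 mulrDl; move: (d * m) (z * m) (d * th) zE => *; lra.
Qed.

(** The order of the choices is what makes the argument work. The number [th]
    bounds below the proportion of choices that put a line over [A] into [D], and
    [z], the admissible error, depends only on [d] and [th]. Then [J1] is a
    dimension in which density [d + z] forces a line, [M] is long enough to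
    partition atoms into [J1]-subspaces, and [I1] contains a monochromatic
    subspace of dimension [M + (I0 + K)]. Only then can [g] be small compared with
    the number of words over [I1], and [J] be a dimension in which density [d + g]
    forces a line. *)
Lemma DHJ_step (d : R) : 0 < d -> (forall e, 0 < e -> DHJ (option A) (d + e)) ->
  exists2 e, 0 < e & DHJ (option A) (d - e).
Proof.
move=> d0 Hd; have [d1|d1] := ltrP 1 d.
  exists ((d - 1) / 2); first by lra.
  exists void => D; have : mean (fun w => (D w)%:R) <= 1 :> R.
    by apply: mean_le_const => // w; case: (D w).
  by move=> h1 h2; exfalso; lra.
pose B : finType := option A.
have [I0 HI0] := DHJ_A (divr_gt0 (divr_gt0 d0 (ltr0Sn R 1)) (ltr0Sn R 1)).
pose th : R := d / 2 / 2 / #|word I0 (option A)|%:R.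
have n0 : (1 : R) <= #|word I0 (option A)|%:R.
  by rewrite ler1n; apply/card_gt0P; exists [ffun=> None].
have th0 : 0 < th by rewrite !divr_gt0 // (lt_le_trans _ n0).
have th1 : th <= 1 / 4.
  rewrite /th ler_pdivrMr ?(lt_le_trans _ n0) //.
  by move: n0; set n := _%:R => n0; nra.
pose z := d * th / 16.
have z0 : 0 < z := divr_gt0 (mulr_gt0 d0 th0) (ltr0Sn R 15).
have zd : z <= d / 64 by have := ler_wpM2l (ltW d0) th1; rewrite /z; lra.
have [J1 HJ1] := Hd z z0.
pose np : R := #|{ffun A -> bool}|%:R.
have np0 : 0 < np by rewrite ltr0n; apply/card_gt0P; exists [ffun=> true].
have [M HM] := insensitive_exhaust_seq a0 DHJ_A (enum A) J1 (divr_gt0 z0 np0).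
have [K HK] := rare_constant A z0.
have [I1 HI1] := Graham_Rothschild_lines a0 (M + (I0 + K))%type.
pose N1 : R := #|word I1 B|%:R.
have N10 : 0 < N1 by rewrite ltr0n; apply/card_gt0P; exists [ffun=> None].
pose g := z / (2 * N1).
have g0 : 0 < g := divr_gt0 z0 (mulr_gt0 (ltr0Sn R 1) N10).
have [J HJ'] := Hd g g0.
exists g => //; exists (I1 + J)%type => D hD.
have [/existsP[v /andP[vv /forallP Dv]]|noline] :=
  boolP [exists v, contains_line v D]; first by exists v.
have {}noline (J' : finType) (s : word (I1 + J)%type (B + J')%type) v : onto s ->
    variable v -> ~ forall b, D (point s (plug b v)).
  move=> os vv h; have [u [vu Du]] := line_in_sub os vv h.
  by case/existsP: noline; exists u; rewrite /contains_line vu; apply/forallP.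
exfalso.
(* No fibre over [x : word I1 B] has density [d + g], so all have density close
   to [d], since [g] was chosen after [I1]. *)
have upper x : mean (fun y => (D (wcat x y))%:R) <= d + g.
  rewrite leNgt; apply/negP => /ltW/(HJ' (fun y => D (wcat x y)))[v [vv Dv]].
  apply: (noline _ (fix_left J x) v) => //; first exact: onto_fix_left.
  by move=> b; rewrite point_fix_left.
have lower x : d - z <= mean (fun y => (D (wcat x y))%:R).
  have := point_lower_bound x upper; rewrite mean_word_cat in hD => /(_ hD).
  by rewrite (_ : 2 * g * _ = z) // /g -/N1; field; rewrite gt_eqF.
have [s [os [b sb]]] := HI1 (fun u =>
  th <= mean (fun y => [forall a, D (wcat (wsome (plug a u)) y)]%:R)).
have {b sb}good w : variable w ->
    th <= mean (fun y => [forall a, D (wcat (wsome (point s (plug a w))) y)]%:R).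
  move=> vw; move: (sb w vw); case: b sb => sb.
    by under eq_mean => y do under eq_forallb => a do rewrite plug_point.
  (* The colour [false] is excluded by a line among the words whose letters
     outside [I0] are all equal to [a0]. *)
  pose E (T : Type) (t : T) (x : word I0 T) : word (M + (I0 + K))%type T :=
    wcat [ffun=> t] (wcat x [ffun=> t]).
  have [||v [vv hv]] := @common_line R A (d / 2) I0 _
      (fun x y => D (wcat (wsome (point s (E _ a0 x))) y)) _ HI0.
  - by rewrite divr_gt0.
  - rewrite -mean_exchange; apply: (@le_trans _ _ (mean (fun _ : word I0 A => d - z))).
      by rewrite (mean_const _ [ffun=> a0]); lra.
    by apply: ler_mean => x; apply: lower.
  have vE : variable (E _ (Some a0) v).
    by rewrite /E !variable_wcat vv orbT.
  have /negP[] := negbT (sb _ vE).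
  apply: le_trans hv _; apply: ler_mean => y.
  rewrite (_ : [forall a, _] = [forall a,
    D (wcat (wsome (plug a (point (enlarge s) (E (option A) (Some a0) v)))) y)]) //.
  apply: eq_forallb => a; rewrite plug_point; congr (D (wcat (wsome (point s _)) y)).
  by rewrite /E !plug_wcat; congr (wcat _ (wcat _ _)); apply/ffunP=> i; rewrite !ffunE.
(* From now on words over [M] vary while the letters in [x : X] are fixed. *)
pose X := (word (I0 + K)%type B * word J B)%type.
pose Dfib (x : X) (w : word M B) := D (wcat (point (enlarge s) (wcat w x.1)) x.2).
pose C a (x : X) (w : word M B) := D (wcat (wsome (point s (plug a (wcat w x.1)))) x.2).
have insC a x : insensitive a (C a x).
  by move=> w; rewrite /C !plug_wcat plug_wsome.
have C_D2 x w : Dfib x w -> [forall a, C a x w] -> ~~ variable w && ~~ variable x.1.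
  move=> hD2 /forallP hC; rewrite -negb_or -variable_wcat; apply/negP => vw.
  pose u := wcat w x.1.
  apply: (noline _ (fix_right (enlarge s) x.2) (widen_line u)).
  - by apply: onto_fix_right; apply: onto_enlarge.
  - exact: variable_widen.
  - move=> [a|]; rewrite point_fix_right ?plug_widen_None // plug_widen_Some point_wsome.
    exact: hC.
have swap (h : X -> word M B -> R) : mean (fun x => mean (h x)) =
    mean (fun w : word (M + (I0 + K))%type B => mean (fun y =>
      h ([ffun i => w (inr i)], y) [ffun i => w (inl i)])).
  rewrite mean_word_cat mean_exchange; apply: eq_mean => w; rewrite mean_pair.
  apply: eq_mean => x; apply: eq_mean => y; congr (h (_, _) _);
    by apply/ffunP=> i; rewrite !ffunE.
pose Call x w := [forall a, C a x w].
pose m := mean (fun x => mean (fun w => (Call x w)%:R : R)).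
have nonvarK (h : X -> word M B -> bool) :
    (forall x w, h x w -> ~~ variable w && ~~ variable x.1) ->
    mean (fun x => mean (fun w => (h x w)%:R)) <= z.
  move=> hh; rewrite mean_pair; apply: (le_trans _ HK).
  rewrite mean_word_cat; apply: mean_le_const => [|x].
    by apply: mean_ge0 => w; rewrite ler0n.
  apply: ler_mean => w; apply: mean_le_const => [|y]; first by rewrite ler0n.
  apply: mean_le_const => [|v]; first by rewrite ler0n.
  have := hh (wcat x w, y) v; case: (h _ _) => [/(_ isT)|_]; last by rewrite ler0n.
  by rewrite /= variable_wcat negb_or => /andP[_ /andP[_ ->]].
(* The intersection [Call] of the insensitive sets [C a] has density at least
   [th / 2]: words with a blank have the proportion [th], and the others are rare
   because of the coordinates [K]. *)
have m_ge : th / 2 <= m.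
  pose nv (x : X) (w : word M B) := ~~ variable (wcat w x.1).
  have nvz : mean (fun x => mean (fun w => (nv x w)%:R)) <= z.
    by apply: nonvarK => x w; rewrite /nv variable_wcat negb_or.
  apply: (@le_trans _ _ (th - mean (fun x => mean (fun w => (nv x w)%:R)))).
    by move: nvz d1 zd; move: (mean _) => t; rewrite /z => *; nra.
  rewrite lerBlDr -meanD (eq_mean (g := fun x => mean (fun w => (Call x w)%:R + (nv x w)%:R)));
    last by move=> x; rewrite meanD.
  rewrite (swap (fun x w => (Call x w)%:R + (nv x w)%:R)).
  rewrite -[leLHS](mean_const _ ([ffun=> None] : word (M + (I0 + K))%type B)).
  apply: ler_mean => w.
  have wE : wcat [ffun i => w (inl i)] [ffun i => w (inr i)] = w.
    by apply/ffunP=> -[i|i]; rewrite !ffunE.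
  have [vw|vw] := boolP (variable w).
    apply: le_trans (good w vw) _; apply: ler_mean => y.
    by rewrite /Call /C /= wE lerDl ler0n.
  rewrite -(mean_const th ([ffun=> None] : word J B)); apply: ler_mean => y.
  rewrite /nv /= wE vw; apply: (@le_trans _ _ 1); first by lra.
  by rewrite lerDr ler0n.
have D_ge : d - z <= mean (fun x => mean (fun w => (Dfib x w)%:R)).
  rewrite (swap (fun x w => (Dfib x w)%:R)).
  rewrite -[leLHS](mean_const _ ([ffun=> None] : word (M + (I0 + K))%type B)).
  apply: ler_mean => w; apply: le_trans (lower (point (enlarge s) w)) _.
  apply: ler_mean => y; rewrite /Dfib /=.
  rewrite (_ : wcat [ffun i => w (inl i)] [ffun i => w (inr i)] = w) //.
  by apply/ffunP=> -[i|i]; rewrite !ffunE.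
pose f x w := (Dfib x w)%:R - (d + z) : R.
(* A positive mean of [f] on a [J1]-subspace would force a line there. *)
have pattern (S : {ffun A -> bool}) :
    mean (fun x => mean (fun w => (all (fun a => C a x w == S a) (enum A))%:R * f x w)) <= z / np.
  apply: (HM _ (fun a x w => C a x w == S a)).
  - by move=> a x w; congr (_ == _); apply: insC.
  - move=> x w; rewrite /f; have : (Dfib x w)%:R <= 1 :> R by case: (Dfib x w).
    by lra.
  - move=> x t /contains_subP[ot _]; rewrite meanB (mean_const _ [ffun=> None]).
    rewrite leNgt subr_gt0; apply/negP => /ltW/(HJ1 (fun w => Dfib x (point t w)))[v [vv Dv]].
    apply: (noline _ (compose (fix_right (enlarge s) x.2) (fix_right t x.1)) v) => //.
      apply: onto_compose; last exact: onto_fix_right.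
      by apply: onto_fix_right; apply: onto_enlarge.
    by move=> b; rewrite point_compose !point_fix_right; apply: Dv.
have outside : mean (fun x => mean (fun w => (~~ Call x w)%:R * f x w)) <= z.
  rewrite (eq_mean (g := fun x => \sum_(S : {ffun A -> bool} | S != [ffun=> true])
     mean (fun w => (all (fun a => C a x w == S a) (enum A))%:R * f x w))); last first.
    move=> x; rewrite /mean -mulr_suml exchange_big; congr (_ / _).
    by apply: eq_bigr => w _; rewrite sum_pattern.
  apply: (@le_trans _ _ (\sum_(S : {ffun A -> bool} | S != [ffun=> true]) z / np)).
    by rewrite /mean exchange_big mulr_suml; apply: ler_sum => S _; apply: pattern.
  apply: (@le_trans _ _ (\sum_(S : {ffun A -> bool}) z / np)).
    by rewrite [leRHS](bigID (fun S => S != [ffun=> true])) /= lerDl sumr_ge0 // => S _;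
      rewrite divr_ge0 // ltW.
  by rewrite sumr_const -mulr_natr -/np divfK // gt_eqF.
(* A word of [Dfib] and [Call] that has a blank would complete a line in [D]. *)
have inside : mean (fun x => mean (fun w => (Call x w && Dfib x w)%:R)) <= z.
  by apply: nonvarK => x w /andP[hC hD2]; apply: C_D2.
apply: (increment_contradiction d0 th0 (erefl z) m_ge); apply: (le_trans D_ge).
apply: (@le_trans _ _ (mean (fun x => mean (fun w => (Call x w && Dfib x w)%:R)) +
   mean (fun x => mean (fun w => (~~ Call x w)%:R * f x w)) + (d + z) * (1 - m))); last first.
  by rewrite lerD2r lerD.
pose x0 : X := ([ffun=> None], [ffun=> None]).
rewrite (eq_mean (g := fun x => mean (fun w => (Call x w && Dfib x w)%:R) +
   mean (fun w => (~~ Call x w)%:R * f x w) +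
   (d + z) * (1 - mean (fun w => (Call x w)%:R)))).
  by rewrite !meanD meanZ meanB (mean_const _ x0).
have one : 1 = mean (fun _ : word M B => 1 : R) by rewrite (mean_const _ [ffun=> None]).
move=> x; rewrite [X in _ * (X - _)]one.
rewrite -meanB -meanZ -!meanD; apply: eq_mean => w.
rewrite /f; case: (Call x w); case: (Dfib x w) => /=; lra.
Qed.

End Step.

(** Any positive infimum of the densities that force a line could be lowered by
    [DHJ_step]. *)
Theorem density_Hales_Jewett (R : realType) (A : finType) (delta : R) :
  0 < delta -> DHJ A delta.
Proof.
move: delta; elim/finType_ind: A => [A B f [g fK gK] HA d d0||A HA].
- have [I HI] := HA d d0; exists I => D dD.
  have bij : bijective (fun x : word I A => [ffun i => f (x i)] : word I B).
    exists (fun y : word I B => [ffun i => g (y i)] : word I A) => x;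
      by apply/ffunP=> i; rewrite !ffunE ?fK ?gK.
  have [|v [vv Dv]] := HI (fun x => D [ffun i => f (x i)]).
    by rewrite -(mean_bij (fun y => (D y)%:R : R) bij).
  exists [ffun i => omap f (v i)]; split.
    by case/variableP: vv => i vi; apply/variableP; exists i; rewrite ffunE vi.
  move=> b; have := Dv (g b); congr (D _); apply/ffunP=> i; rewrite !ffunE.
  by case: (v i) => //=; rewrite gK.
- move=> d d0; exists unit => D _; exists [ffun=> None]; split=> [|[]].
  by apply/variableP; exists tt; rewrite ffunE.
have [A0|/card_gt0P[a0 _]] := posnP #|A|.
  move=> d d0; exists unit => D /(exists_ge_mean d0)[w].
  case Dw: (D w); last by rewrite leNgt d0.
  move=> _; exists [ffun=> None]; split=> [|a].
    by apply/variableP; exists tt; rewrite ffunE.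
  have E (b : option A) : b = None by case: b => // b; have := fintype0 b; rewrite A0.
  by rewrite (_ : plug a _ = w) //; apply/ffunP=> i; rewrite [LHS]E [RHS]E.
pose S := [set d : R | 0 < d /\ DHJ (option A) d]%classic.
have S2 : S 2.
  split=> //; exists void => D; have : mean (fun w => (D w)%:R) <= 1 :> R.
    by apply: mean_le_const => // w; case: (D w).
  by move=> h1 h2; exfalso; lra.
have S0 : lbound S 0 by move=> d [/ltW].
have hS : has_inf S by split; [exists 2|exists 0].
have above e : 0 < e -> DHJ (option A) (inf S + e).
  by move=> e0; have [x [_ hx] /ltW xe] := inf_adherent e0 hS; apply: DHJ_le hx.
have s0 : 0 <= inf S by apply: lb_le_inf => //; exists 2.
move=> d d0; have [sp|s_le0] := ltrP 0 (inf S); last first.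
  have <- : inf S + d = d by rewrite (_ : inf S = 0) ?add0r //; apply/le_anti/andP.
  exact: above.
have [e e0 he] := DHJ_step a0 (fun d => @HA d) sp above.
have : inf S <= Num.max (inf S - e) (inf S / 2).
  apply: ge_inf; first by exists 0.
  split; first by rewrite lt_max orbC divr_gt0.
  by apply: DHJ_le he; rewrite le_max lexx.
by rewrite le_max => /orP[]; move: (inf S) sp => s sp; lra.
Qed.

Local Open Scope classical_set_scope.
Local Open Scope ring_scope.

(** * The outer Haar measure *)

Section Translation.
Variable G : zmodType.
Implicit Types (g h : G) (A B : set G).

Lemma translateE g A : translate g A = [set x | A (x - g)].
Proof.
apply/seteqP; split=> x /=; first by move=> [y Ay <-]; rewrite addrC addKr.
by move=> Ax; exists (x - g) => //; rewrite addrC subrK.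
Qed.

Lemma translateD g h A : translate g (translate h A) = translate (g + h) A.
Proof. by rewrite !translateE; apply/seteqP; split=> x /=; rewrite opprD addrA. Qed.

Lemma translate0 A : translate 0 A = A.
Proof. by rewrite translateE; apply/seteqP; split=> x /=; rewrite subr0. Qed.

Lemma translateI g A B : translate g (A `&` B) = translate g A `&` translate g B.
Proof. by rewrite !translateE. Qed.

Lemma translateY g A B : translate g (A `+` B) = translate g A `+` translate g B.
Proof. by rewrite !translateE. Qed.

End Translation.

Section Haar.
Variables (R : realType) (G : topologicalZmodType).
Variable mu : {measure set (borelType G) -> \bar R}.
Hypothesis mu_haar : is_haar mu.

Lemma measurable_translate (g : G) (A : set (borelType G)) :
  measurable A -> measurable (translate g A : set (borelType G)).
Proof.
have cont : continuous (fun x : G => x - g).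
  move=> x; apply: (@continuous_comp _ _ _ (fun x => (x, - g)) (fun x : G * G => x.1 + x.2)).
    by apply: cvg_pair => /=; [exact: cvg_id|exact: cvg_cst].
  exact: add_continuous.
move: A; apply: smallest_sub; last first.
  move=> U oU /=; rewrite translateE; apply: sub_sigma_algebra.
  by move/continuousP: cont => /(_ U oU).
split=> /=.
- by rewrite translateE; exact: measurable0.
- move=> A; rewrite setTD !translateE => mA.
  exact: measurableC mA.
- move=> A mA; rewrite translateE.
  have : measurable (\bigcup_i (translate g (A i) : set (borelType G))).
    by apply: bigcupT_measurable.
  by congr measurable; apply/seteqP; split=> x [i _]; rewrite ?translateE => h; exists i => //;
    rewrite translateE.
Qed.

Lemma outer_haar_translate (g : G) (A : set G) :
  ((mu^*)%mu (translate g A) = (mu^*)%mu A)%E.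
Proof.
have le h B : ((mu^*)%mu (translate h B) <= (mu^*)%mu B)%E.
  apply: le_ereal_inf_tmp => _ [C [mC BC] <-]; apply: ereal_inf_lbound.
  exists (fun n => translate h (C n)).
    split=> [n|x]; first exact: measurable_translate.
    rewrite translateE /= => /BC[n _ Cn]; exists n => //.
    by rewrite translateE.
  by apply: eq_eseriesr => n _; apply: haar_translate.
apply/le_anti/andP; split; first exact: le.
by rewrite -[X in (_ X <= _)%E]translate0 -(addNr g) -translateD.
Qed.

Lemma outer_haar_compact (Ghaus : hausdorff_space G) (K : set G) : compact K ->
  ((mu^*)%mu K < +oo)%E.
Proof.
move=> cK; rewrite measurable_mu_extE; first exact: haar_compact cK.
rewrite -[K]setCK; apply: measurableC; apply: sub_sigma_algebra.
by rewrite openC; apply: compact_closed.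
Qed.

End Haar.

(** * Relative density along an asymptotically invariant sequence *)

Lemma pigeonhole_infinite (T : finType) (P : nat -> T -> Prop) :
  (forall N, exists2 n, (N <= n)%N & exists t, P n t) ->
  exists t, forall N, exists2 n, (N <= n)%N & P n t.
Proof.
move=> h; apply: contrapT => /forallNP no.
have {}no t : exists N, forall n, (N <= n)%N -> ~ P n t.
  have /existsNP[N hN] := no t; exists N => n Nn Pnt.
  by apply: hN; exists n.
have [N hN] := choice no.
have [n Nn [t]] := h (\max_t N t).
by apply: (hN t); apply: leq_trans Nn; apply: leq_bigmax.
Qed.

Section RelativeDensity.
Variables (R : realType) (G : zmodType) (m : {outer_measure set G -> \bar R}).
Variable Fs : nat -> set G.
Hypothesis m_translate : forall g A, m (translate g A) = m A.
Hypothesis Fs_gt0 : forall n, (0 < m (Fs n))%E.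
Hypothesis Fs_fin : forall n, (m (Fs n) < +oo)%E.

Definition reldens n (A : set G) : R := fine (m (A `&` Fs n)) / fine (m (Fs n)).

Let fin_sub n A : A `<=` Fs n -> m A \is a fin_num.
Proof.
move=> AF; rewrite ge0_fin_numE ?outer_measure_ge0 //.
by apply: le_lt_trans (Fs_fin n); apply: le_outer_measure.
Qed.

Let fine_gt0 n : 0 < fine (m (Fs n)).
Proof. by rewrite -lte_fin fineK ?Fs_gt0 // (@fin_sub n). Qed.

Lemma ediv_fin n (x : \bar R) : x \is a fin_num ->
  (x / m (Fs n))%E = (fine x / fine (m (Fs n)))%:E.
Proof.
move=> xfin; have mF : m (Fs n) \is a fin_num by exact: (@fin_sub n).
by rewrite -(fineK mF) inver gt_eqF // -{1}(fineK xfin) -EFinM.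
Qed.

Lemma reldensE n A : (m (A `&` Fs n) / m (Fs n))%E = (reldens n A)%:E.
Proof. by rewrite ediv_fin //; apply: (@fin_sub n); apply: subIsetr. Qed.

Lemma reldens_ge0 n A : 0 <= reldens n A.
Proof. by rewrite divr_ge0 // fine_ge0 // outer_measure_ge0. Qed.

Lemma le_reldens n A B : A `<=` B -> reldens n A <= reldens n B.
Proof.
move=> AB; rewrite ler_wpM2r ?invr_ge0 ?(ltW (fine_gt0 n)) //.
apply: fine_le; [exact: (fin_sub (@subIsetr _ A _))|exact: (fin_sub (@subIsetr _ B _))|].
by apply: le_outer_measure; apply: setSI.
Qed.

Lemma reldensT n : reldens n setT = 1.
Proof. by rewrite /reldens setTI divff // gt_eqF. Qed.

(** An atom of the algebra of sets generated by the [A t]: the points [u] for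
    which [S] is the set of the [t] with [u] in [A t]. *)
Definition atom (T : finType) (A : T -> set G) (S : {ffun T -> bool}) : set G :=
  [set u | forall t, S t = `[< A t u >]].

Lemma sum_atoms (T : finType) (A : T -> set G) (X : set G) :
  (forall t, m.-caratheodory (A t)) ->
  (m X = \sum_(S : {ffun T -> bool}) m (X `&` atom A S))%E.
Proof.
elim/finType_ind: T A X => [T U f [g fK gK] IH||T IH] A X mA.
- rewrite (IH (fun t => A (f t)) X (fun t => mA _)).
  rewrite (reindex (fun S : {ffun U -> bool} => [ffun t => S (f t)])) /=; last first.
    apply: onW_bij; exists (fun S : {ffun T -> bool} => [ffun u => S (g u)]) => S;
      by apply/ffunP=> x; rewrite !ffunE ?fK ?gK.
  apply: eq_bigr => S _; congr (m (_ `&` _)); apply/seteqP; split=> u hu t.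
    by have := hu (g t); rewrite ffunE gK.
  by rewrite ffunE.
- rewrite (bigD1 [ffun x : void => match x with end]) //= big1 ?adde0.
    by congr (m _); apply/seteqP; split=> [u Xu|u []//]; split=> // -[].
  by move=> S /eqP[]; apply/ffunP=> -[].
rewrite (reindex (fun p : bool * {ffun T -> bool} => wcons p.1 p.2)) /=; last first.
  apply: onW_bij; exists (fun S : {ffun option T -> bool} => (S None, [ffun t => S (Some t)])).
    by move=> [b S]; congr pair; rewrite ?ffunE //; apply/ffunP=> t; rewrite !ffunE.
  by move=> S; apply/ffunP=> -[t|]; rewrite !ffunE.
rewrite -(pair_bigA _ (fun b S => m (X `&` atom A (wcons b S)))) big_bool /= -big_split /=.
rewrite (IH (fun t => A (Some t)) X (fun t => mA _)); apply: eq_bigr => S _.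
rewrite (mA None (X `&` _)); congr (m _ + m _)%E; rewrite -setIA; congr (X `&` _).
  apply/seteqP; split=> u /=.
    by move=> [hS uA] [t|]; rewrite ffunE; [exact: hS|apply/esym/asboolP].
  move=> hS; split; first by move=> t; have := hS (Some t); rewrite ffunE.
  by have := hS None; rewrite ffunE => /esym/asboolP.
apply/seteqP; split=> u /=.
  by move=> [hS uA] [t|]; rewrite ffunE; [exact: hS|apply/esym/asboolP].
move=> hS; split; first by move=> t; have := hS (Some t); rewrite ffunE.
by have := hS None; rewrite ffunE => /esym/asboolP.
Qed.

Lemma reldens_atoms (T : finType) (A : T -> set G) (X : set G) n :
  (forall t, m.-caratheodory (A t)) ->
  reldens n X = \sum_(S : {ffun T -> bool}) reldens n (X `&` atom A S).
Proof.
move=> mA; rewrite /reldens -mulr_suml; congr (_ / _).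
apply: EFin_inj; rewrite fineK; last exact: (fin_sub (@subIsetr _ _ _)).
rewrite -sumEFin (sum_atoms _ mA); apply: eq_bigr => S _.
by rewrite setIAC fineK //; exact: (fin_sub (@subIsetr _ _ _)).
Qed.

(** Positive upper density, as a bound attained for infinitely many [n], to which
    the pigeonhole principle applies. *)
Definition frequent (A : set G) :=
  exists2 e : R, 0 < e & forall N, exists2 n, (N <= n)%N & e <= reldens n A.

Lemma frequentP (A : set G) : (0 < upper_density m Fs A)%E <-> frequent A.
Proof.
rewrite /upper_density limn_esup_lim (eq_fun (reldensE ^~ A) : _ = fun n => _).
have -> : limn (esups (fun n => (reldens n A)%:E)) =
    ereal_inf (range (esups (fun n => (reldens n A)%:E))).
  by apply/cvg_lim => //; apply: cvg_esups_inf.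
split.
  rewrite lt_neqAle => /andP[+ ge0]; set I := ereal_inf _ in ge0 * => I0.
  have [e e0 eI] : exists2 e : R, 0 < e & (e%:E < I)%E.
    case: (I) I0 ge0 => [r r0 rge0|_ _|//].
      exists (r / 2); rewrite ?lte_fin.
        by rewrite divr_gt0 // lt_neqAle -lee_fin rge0 andbT; move: r0; rewrite eqe.
      suff : 0 < r by lra.
      by rewrite lt_neqAle -lee_fin rge0 andbT; move: r0; rewrite eqe.
    by exists 1 => //; rewrite ltry.
  exists e => // N.
  have : (I <= esups (fun n => (reldens n A)%:E) N)%E by apply: ereal_inf_lbound; exists N.
  move=> /(lt_le_trans eI)/ereal_sup_gt[_ [n Nn <-]]; rewrite lte_fin => /ltW.
  by exists n.
move=> [e e0 he]; apply: (@lt_le_trans _ _ e%:E); first by rewrite lte_fin.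
apply: le_ereal_inf_tmp => _ [N _ <-]; have [n Nn ne] := he N.
apply: (@le_trans _ _ (reldens n A)%:E); first by rewrite lee_fin.
by apply: ereal_sup_ubound; exists n.
Qed.

Lemma le_frequent A B : A `<=` B -> frequent A -> frequent B.
Proof.
move=> AB [e e0 h]; exists e => // N; have [n Nn ne] := h N.
by exists n => //; apply: le_trans ne (le_reldens _ AB).
Qed.

Definition drift n h : R := fine (m (translate h (Fs n) `+` Fs n)) / fine (m (Fs n)).

Let fin_transl n h : m (translate h (Fs n) `+` Fs n) \is a fin_num.
Proof.
rewrite ge0_fin_numE ?outer_measure_ge0 //.
apply: (@le_lt_trans _ _ (m (translate h (Fs n)) + m (Fs n))%E).
  apply: le_trans (outer_measureU2 _ _ _); apply: le_outer_measure.
  by move=> x [[]|[]]; [left|right].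
by rewrite m_translate lte_add_pinfty.
Qed.

Definition almost_invariant h := forall e : R, 0 < e ->
  exists N, forall n, (N <= n)%N -> drift n h <= e.

Lemma almost_invariant_folner h :
  (m (translate h (Fs n) `+` Fs n) / m (Fs n))%E @[n --> \oo] --> (0 : \bar R)%E ->
  almost_invariant h.
Proof.
move=> hc e e0; have E : (fun n => (m (translate h (Fs n) `+` Fs n) / m (Fs n))%E) =
    (fun n => (drift n h)%:E) by apply/funext => n; rewrite ediv_fin.
move: hc; rewrite E => /fine_cvgP[_] /cvgrPdist_le /(_ e e0)[N _ hN].
exists N => n Nn; apply: le_trans (hN n Nn) => /=.
by rewrite sub0r normrN ler_norm.
Qed.

Lemma almost_invariant0 : almost_invariant 0.
Proof.
move=> e e0; exists 0%N => n _; rewrite /drift translate0.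
rewrite (_ : _ `+` _ = set0) ?outer_measure0 ?mul0r ?ltW //.
by apply/seteqP; split=> x // [[]|[]].
Qed.

(** Translating by [h] turns the difference of the translates by [g - h] and [0]
    into that of the translates by [g] and [h]. *)
Lemma driftB n g h : drift n (g - h) <= drift n g + drift n h.
Proof.
rewrite /drift -mulrDl ler_wpM2r ?invr_ge0 ?(ltW (fine_gt0 n)) //.
rewrite -fineD //; apply: fine_le; rewrite ?inE ?fin_numD ?fin_transl //.
rewrite -(m_translate h) translateY translateD addrC subrK.
apply: le_trans (outer_measureU2 _ _ _); apply: le_outer_measure => x.
have [] := pselect (Fs n x); rewrite /setY /setU /setD /=; tauto.
Qed.

Lemma almost_invariantB g h : almost_invariant g -> almost_invariant h ->
  almost_invariant (g - h).
Proof.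
move=> hg hh e e0; have e2 : 0 < e / 2 by rewrite divr_gt0.
have [N1 h1] := hg _ e2; have [N2 h2] := hh _ e2.
exists (maxn N1 N2) => n; rewrite geq_max => /andP[/h1 {}h1 /h2 {}h2].
by apply: le_trans (driftB _ _ _) _; rewrite [e]splitr lerD.
Qed.

Lemma almost_invariantN g : almost_invariant g -> almost_invariant (- g).
Proof. by move=> hg; rewrite -sub0r; apply: almost_invariantB => //; apply: almost_invariant0. Qed.

Lemma almost_invariantD g h : almost_invariant g -> almost_invariant h ->
  almost_invariant (g + h).
Proof. by move=> hg /almost_invariantN hh; rewrite -[h]opprK; apply: almost_invariantB. Qed.

Lemma almost_invariantMn g k : almost_invariant g -> almost_invariant (g *+ k).
Proof.
move=> hg; elim: k => [|k IH]; first exact: almost_invariant0.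
by rewrite mulrS; apply: almost_invariantD.
Qed.

Lemma almost_invariantMz g k : almost_invariant g -> almost_invariant (g *~ k).
Proof.
by move=> hg; case: k => k; [|rewrite NegzE mulrNz; apply: almost_invariantN];
  apply: almost_invariantMn.
Qed.

Lemma almost_invariant_sum (I : finType) (f : I -> G) :
  (forall i, almost_invariant (f i)) -> almost_invariant (\sum_i f i).
Proof.
move=> hf; elim/big_ind: _ => //; [exact: almost_invariant0|exact: almost_invariantD].
Qed.

Lemma almost_invariant_gen (F : set G) g : (forall f, F f -> almost_invariant f) ->
  subgroup_gen F g -> almost_invariant g.
Proof.
move=> hF; move: g; apply: smallest_sub => //=.
split; first by rewrite inE; exact: almost_invariant0.
by move=> x y; rewrite !inE; exact: almost_invariantB.
Qed.

Lemma reldens_translate n h A : reldens n (translate h A) <= reldens n A + drift n h.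
Proof.
rewrite /reldens /drift -mulrDl ler_wpM2r ?invr_ge0 ?(ltW (fine_gt0 n)) //.
have fA : m (A `&` Fs n) \is a fin_num by exact: (fin_sub (@subIsetr _ A _)).
rewrite -fineD //; apply: fine_le; rewrite ?fin_numD ?inE ?fA ?fin_transl //.
  exact: (fin_sub (@subIsetr _ _ _)).
rewrite -[X in (_ <= X + _)%E](m_translate h) translateI.
apply: le_trans (outer_measureU2 _ _ _); apply: le_outer_measure => x [hA Fx].
by have [hF|hF] := pselect (translate h (Fs n) x); [left|right; right].
Qed.

Lemma frequent_translate h A : almost_invariant h ->
  frequent (translate h A) -> frequent A.
Proof.
move=> hh [e e0 he]; have e2 : 0 < e / 2 by rewrite divr_gt0.
exists (e / 2) => // N; have [N' hN'] := hh _ e2.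
have [n nN ne] := he (maxn N N'); move: nN; rewrite geq_max => /andP[Nn /hN' dn].
by exists n => //; have := reldens_translate n h A; lra.
Qed.

Lemma caratheodory_translate h (A : set G) : m.-caratheodory A ->
  m.-caratheodory (translate h A).
Proof.
move=> mA X; rewrite -(m_translate (- h) X) (mA (translate (- h) X)).
congr (_ + _)%E; rewrite -(m_translate h) translateI translateD subrr translate0 //.
by congr (m (_ `&` _)); rewrite !translateE.
Qed.

End RelativeDensity.

(** * Recurrence along finite sums *)

Section IPRecurrence.
Variables (R : realType) (G : zmodType) (m : {outer_measure set G -> \bar R}).
Variable Fs : nat -> set G.
Hypothesis m_translate : forall g A, m (translate g A) = m A.
Hypothesis Fs_gt0 : forall n, (0 < m (Fs n))%E.
Hypothesis Fs_fin : forall n, (m (Fs n) < +oo)%E.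
Local Notation reldens := (reldens m Fs).
Local Notation frequent := (frequent m Fs).
Local Notation almost_invariant := (almost_invariant m Fs).

(** By double counting, [e] is at most the sum over the atoms [S] of the relative
    density of [S] times the proportion of indices in [S]. Atoms with few indices
    contribute at most [e / 2], so some other atom is large. *)
Lemma dense_atom (T : finType) (t0 : T) (A : T -> set G) n (e : R) : 0 < e ->
  (forall t, m.-caratheodory (A t)) -> (forall t, e <= reldens n (A t)) ->
  exists S : {ffun T -> bool}, e / 2 <= mean (fun t => (S t)%:R) /\
    e / 4 / #|{ffun T -> bool}|%:R <= reldens n (atom A S).
Proof.
move=> e0 mA hA; set c := e / 4 / _.
have c0 : 0 < c.
  by rewrite !divr_gt0 ?ltr0n //; apply/card_gt0P; exists [ffun=> true].
pose p S := reldens n (atom A S).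
have p0 S : 0 <= p S by apply: reldens_ge0.
have p1 : \sum_S p S = 1.
  rewrite -(reldensT Fs_gt0 Fs_fin n) (reldens_atoms Fs_fin _ _ mA).
  by apply: eq_bigr => S _; rewrite setTI.
apply: contrapT => /forallNP no.
have {}no (S : {ffun T -> bool}) : mean (fun t => (S t)%:R) * p S <= e / 2 * p S + c.
  have [hS|hS] := lerP (e / 2) (mean (fun t => (S t)%:R)).
    have [//|hp] := lerP c (p S); first by move=> cp; case: (no S).
    have : mean (fun t => (S t)%:R) <= 1 :> R.
      by apply: mean_le_const => // t; case: (S t).
    have : 0 <= e / 2 * p S by rewrite mulr_ge0 // divr_ge0 // ltW.
    by move: (p0 S) hp; move: (mean _) (p S) => a b; nra.
  apply: (@le_trans _ _ (e / 2 * p S)); first by rewrite ler_wpM2r // ltW.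
  by rewrite lerDl ltW.
have : e <= \sum_(S : {ffun T -> bool}) mean (fun t => (S t)%:R) * p S.
  apply: (@le_trans _ _ (mean (fun t => \sum_(S : {ffun T -> bool}) (S t)%:R * p S))).
    rewrite -[leLHS](mean_const e t0); apply: ler_mean => t.
    apply: le_trans (hA t) _; rewrite (reldens_atoms Fs_fin _ _ mA).
    apply: ler_sum => S _; case St: (S t).
      by rewrite mul1r; apply: le_reldens => // u [].
    rewrite mul0r /reldens (_ : _ `&` atom A S = set0) ?set0I ?outer_measure0 ?mul0r //.
    apply/seteqP; split=> u // [Atu /(_ t)]; rewrite St => /esym/asboolP.
    by apply: contra_notP => _.
  rewrite mean_sum; apply: ler_sum => S _.
  by rewrite (eq_mean (g := fun t => p S * (S t)%:R)) ?meanZ 1?mulrC // => t; rewrite mulrC.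
apply/negP; rewrite -ltNge; apply: le_lt_trans (ler_sum _ (fun S _ => no S)) _.
rewrite big_split /= -mulr_sumr p1 sumr_const -[X in _ + X]mulr_natr /c divfK; first by lra.
by rewrite pnatr_eq0 -lt0n; apply/card_gt0P; exists [ffun=> true].
Qed.

(** The relative density of each [A t] is eventually close to that of [E] for the
    same [n], which allows an atom to be selected for infinitely many [n]
    simultaneously; the line is then taken among the words of this atom. *)
Theorem IP_recurrence (B : finType) (b0 : B) (gs : B -> G) (E : set G) :
  (forall b, almost_invariant (gs b)) -> m.-caratheodory E -> frequent E ->
  exists I : finType, forall d : I -> int, exists P : I -> bool,
    (exists i, P i) /\
    frequent [set u | forall b, E (u + gs b *~ (\sum_(i | P i) d i))].
Proof.
move=> hgs mE [e e0 hE]; have e2 : 0 < e / 2 by rewrite divr_gt0.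
have [I HI] := density_Hales_Jewett B (divr_gt0 e2 (ltr0Sn R 1)).
exists I => d.
pose tau (t : word I B) := \sum_i gs (t i) *~ d i.
have inv_tau t : almost_invariant (tau t).
  by apply: almost_invariant_sum => // i; apply: almost_invariantMz.
pose A t := translate (- tau t) E.
have mA t : m.-caratheodory (A t) by apply: caratheodory_translate.
have [N hN] := choice (fun t => inv_tau t _ e2).
have [S hS] : exists S : {ffun word I B -> bool}, forall M, exists2 n, (M <= n)%N &
    e / 2 / 2 <= mean (fun t => (S t)%:R) /\
    e / 2 / 4 / #|{ffun word I B -> bool}|%:R <= reldens n (atom A S).
  apply: pigeonhole_infinite => M.
  have [n Mn hn] := hE (maxn M (\max_t N t)); move: Mn; rewrite geq_max => /andP[Mn Nn].
  exists n => //; apply: dense_atom => //; first exact: [ffun=> b0].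
  move=> t; have := reldens_translate m_translate Fs_gt0 Fs_fin n (tau t) (A t).
  rewrite translateD subrr translate0.
  have : drift m Fs n (tau t) <= e / 2.
    by apply: hN; apply: leq_trans Nn; apply: leq_bigmax.
  by lra.
have [v [/variableP vv Sv]] := HI S (let: ex_intro2 n _ h := hS 0%N in proj1 h).
have freqS : frequent (atom A S).
  exists (e / 2 / 4 / #|{ffun word I B -> bool}|%:R).
    by rewrite !divr_gt0 ?ltr0n //; apply/card_gt0P; exists [ffun=> true].
  by move=> M; have [n Mn [_ hn]] := hS M; exists n.
exists (fun i => v i == None); split; first by case: vv => i /eqP; exists i.
(* The default letter [b0] is never read: the sum runs over constant letters. *)
pose c := \sum_(i | v i != None) gs (odflt b0 (v i)) *~ d i.
have tauE b : tau (plug b v) = c + gs b *~ (\sum_(i | v i == None) d i).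
  rewrite /tau (bigID (fun i => v i == None)) /= addrC; congr (_ + _).
    by apply: eq_bigr => i vi; rewrite ffunE; case: (v i) vi.
  rewrite mulrz_sumr; apply: eq_bigr => i /eqP vi.
  by rewrite ffunE vi.
apply: (frequent_translate m_translate Fs_gt0 Fs_fin (h := - c)).
  apply: almost_invariantN => //; rewrite /c big_mkcond /=.
  apply: almost_invariant_sum => // i; case: ifP => _; last exact: almost_invariant0.
  exact: almost_invariantMz.
apply: le_frequent freqS => // u hu; rewrite translateE /= => b.
have := hu (plug b v); rewrite Sv => /esym/asboolP.
by rewrite /A translateE /= opprK opprK tauE addrA.
Qed.

End IPRecurrence.

(** * From finite sums to bounded gaps and density *)

Lemma sum_option (V : nmodType) (I : finType) (f : option I -> V) :
  \sum_o f o = f None + \sum_i f (Some i).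
Proof.
rewrite (bigD1 None) //=; congr (_ + _).
rewrite (reindex_omap (@Some I) id) /=; last by case.
by apply: eq_bigl => i; rewrite eqxx.
Qed.

(** If the gaps of [S] are unbounded, the integers [d i] are chosen one after the
    other: the next one is the middle of a gap longer than twice the sum of the
    absolute values of the previous ones, so that adding any of these stays in
    the gap. *)
Lemma IP_syndetic (S : set int) (I : finType) :
  (forall d : I -> int, exists P : I -> bool,
     (exists i, P i) /\ S (\sum_(i | P i) d i)) ->
  exists2 L : nat, (0 < L)%N & forall M : int, exists2 d, S d & M <= d < M + L%:Z.
Proof.
move=> hS; apply: contrapT => no.
have {}no (L : nat) : exists M : int, forall d, M <= d < M + L.+1%:Z -> ~ S d.
  apply: contrapT => /forallNP h; apply: no; exists L.+1 => // M.
  by have /existsNP[d /not_implyP[hd /contrapT Sd]] := h M; exists d.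
suff [d hd] : exists d : I -> int, forall P : I -> bool, (exists i, P i) ->
    ~ S (\sum_(i | P i) d i) by have [P [hP]] := hS d; apply: hd.
elim/finType_ind: I {hS} => [I J f [g fK gK] [d hd]||I [d hd]].
- exists (d \o g) => P [j Pj]; rewrite (reindex f) /=; last by apply: onW_bij; exists g.
  under eq_bigr => i _ do rewrite fK.
  by apply: hd; exists (g j); rewrite gK.
- by exists (fun=> 0) => P [[]].
pose L := \sum_i `|d i|.
have [M hM] := no (2 * absz L)%N.
exists (fun o => if o is Some i then d i else M + L) => P hP.
rewrite big_mkcond sum_option /= -big_mkcond /=.
case PN: (P None); last first.
  rewrite add0r; apply: hd; case: hP => -[i Pi|]; last by rewrite PN.
  by exists i.
have : `|\sum_(i | P (Some i)) d i| <= L.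
  apply: le_trans (ler_norm_sum _ _ _) _; rewrite big_mkcond /L.
  by apply: ler_sum => i _; case: ifP.
move: (\sum_(i | _) _) => s sL; apply: hM; lia.
Qed.

Lemma counting_ge_size (R : realType) (T : choiceType) (X : set T) (s : seq T) :
  uniq s -> (forall x, x \in s -> X x) -> ((size s)%:R%:E <= counting X :> \bar R)%E.
Proof.
move=> us sX; rewrite /counting; case: ifPn => [/asboolP finX|_]; last exact: leey.
rewrite lee_fin ler_nat; apply: uniq_leq_size => // x /sX Xx.
by rewrite in_fset_set // inE.
Qed.

Lemma syndetic_density (R : realType) (S : set int) (L : nat) : (0 < L)%N ->
  (forall M : int, exists2 d, S d & M <= d < M + L%:Z) ->
  (0 < lower_banach_density R S)%E.
Proof.
move=> L0 hS; have {hS}[f hf] := choice (fun M => let: ex_intro2 d h1 h2 := hS M in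
  ex_intro (fun d => S d /\ M <= d < M + L%:Z) d (conj h1 h2)).
have c0 : 0 < (2 * L%:R)^-1 :> R by rewrite invr_gt0 mulr_gt0 ?ltr0n.
apply: (@lt_le_trans _ _ ((2 * L%:R)^-1)%:E); first by rewrite lte_fin.
apply: le_ereal_sup_tmp; eexists; first by exists L.
apply: le_ereal_inf_tmp => _ [[M N] /= LMN <-].
have [n nE] : exists n : nat, N - M = n%:Z by exists (absz (N - M)); lia.
rewrite nE in LMN *; pose q := (n %/ L)%N.
have n0 : 0 < n%:R :> R by rewrite ltr0n; lia.
pose s := [seq f (M + (i * L)%:Z) | i <- iota 0 q].
have us : uniq s.
  rewrite map_inj_uniq ?iota_uniq // => i j fij.
  have [_ /andP[]] := hf (M + (i * L)%:Z); have [_ /andP[]] := hf (M + (j * L)%:Z).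
  by rewrite fij; nia.
have sX x : x \in s -> (S `&` [set` `[M, N[%R]) x.
  move=> /mapP[i]; rewrite mem_iota add0n => /andP[_ iq] ->.
  have [Sf /andP[h1 h2]] := hf (M + (i * L)%:Z); split=> //.
  rewrite /= in_itv /=.
  have : (i.+1 * L <= n)%N by rewrite (leq_trans _ (leq_divM n L)) // leq_mul.
  by move: h1 h2 nE; move: (f _) => y h1 h2 nE; lia.
have := counting_ge_size R us sX; rewrite size_map size_iota => hc.
apply: (@le_trans _ _ (q%:R%:E / (n%:R)%:E)%E); last first.
  by apply: lee_wpmul2r => //; rewrite inve_ge0 lee_fin ltW.
rewrite inver gt_eqF // -EFinM lee_fin ler_pdivlMr // mulrC ler_pdivrMr ?mulr_gt0 ?ltr0n //.
rewrite -natrM -natrM ler_nat.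
have := divn_eq n L; have := ltn_pmod n L0; rewrite -/q.
have : (0 < q)%N by rewrite divn_gt0 //; lia.
by move: (n %% L)%N => r; nia.
Qed.

(** The letters are [None], which stands for [0], and the indices of the [g i]. *)
Theorem theorem3p1 (R : realType) (G : topologicalZmodType)
    (Ghaus : hausdorff_space G) (Gloc : locally_compact [set: G])
    (mu : {measure set (borelType G) -> \bar R}) (mu_haar : is_haar mu)
    (F : set G) (Fcompact : compact F)
    (Fs : nat -> set G) (Fs_folner : folner (mu^*)%mu F Fs)
    (E : set G) (Emeas : ((mu^*)%mu).-caratheodory E)
    (Epos : (0 < upper_density (mu^*)%mu Fs E)%E)
    (l : nat) (g : 'I_l -> G) (gF : forall i, subgroup_gen F (g i)) :
  (0 < lower_banach_density R
     [set d : int | (0 < upper_density (mu^*)%mu Fs (pattern_set E g d))%E])%E.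
Proof.
pose m : {outer_measure set (borelType G) -> \bar R} := (mu^*)%mu.
have m_translate h A : m (translate h A) = m A by exact: outer_haar_translate.
have Fs_gt0 n : (0 < m (Fs n))%E by exact: folner_gt0 Fs_folner n.
have Fs_fin n : (m (Fs n) < +oo)%E.
  by apply: outer_haar_compact => //; exact: folner_compact Fs_folner n.
pose gs o := if o is Some i then g i else 0.
have inv_gs o : almost_invariant m Fs (gs o).
  case: o => [i|]; last exact: almost_invariant0.
  apply: (almost_invariant_gen m_translate Fs_gt0 Fs_fin _ (gF i)) => f Ff.
  apply: almost_invariant_folner => //; exact: folner_cvg Fs_folner f Ff.
have [I HI] := IP_recurrence m_translate Fs_gt0 Fs_fin None inv_gs Emeas
  (proj1 (frequentP Fs_gt0 Fs_fin E) Epos).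
have [L L0 hL] : exists2 L : nat, (0 < L)%N & forall M : int, exists2 d,
    [set d : int | (0 < upper_density m Fs (pattern_set E g d))%E] d & M <= d < M + L%:Z.
  apply: (@IP_syndetic _ I) => d; have [P [hP freqP]] := HI d.
  exists P; split=> //=; apply/(frequentP Fs_gt0 Fs_fin).
  apply: le_frequent freqP => // u hu; split.
    by have := hu None; rewrite mul0rz addr0.
  by move=> _ [i _ <-]; exact: (hu (Some i)).
exact: syndetic_density L0 hL.
Qed.
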